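(* Let $K$ be a connected compact set in $\mathbb C^n$ containing $0$, and let $R,s$ be positive numbers. There exists a positive constant $C=C(K,R,s)$, depending only on $K$, $R$ and $s$ (and $n$), such that the following holds. Let $r$ satisfy $R>2r>2s>0$, and let $D$ be a domain in $\mathbb C^n$ such that $B(0,2r)\subset D\subset B(0,R)$ and such that the $3s$-neighborhood of $K$ is contained in $D$. Then $$\|X\|_K\le C\,\|X\|_{B(0,r)}$$ for each holomorphic vector field $X$ on $D$ generated by a one-parameter group action $g(z,t)$ on $D$.
   Context: A one-parameter group action on a bounded domain $D$ is a one-parameter subgroup $g(\cdot,t)$, $t\in\mathbb R$, of the Lie group $\operatorname{Aut}(D)$ of biholomorphic self-maps of $D$, so $g(z,0)=z$ and $g(z,t+s)=g(g(z,t),s)$; it generates the holomorphic vector field $X(z)=\frac{\partial g}{\partial t}(z,0)$, $X:D\to\mathbb C^n$. $B(p,r)$ is the open Euclidean ball with center $p$ and radius $r$, and $\|X\|_E=\sup_{z\in E}|X(z)|$ with $|\cdot|$ the Euclidean norm. *)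

(* Defs.v *)
From HB Require Import structures.
From mathcomp Require Import all_boot all_order all_algebra.
From mathcomp Require Import complex.
From mathcomp Require Import all_classical all_reals all_analysis.

Set Implicit Arguments.
Unset Strict Implicit.
Unset Printing Implicit Defensive.

Import Order.TTheory GRing.Theory Num.Theory.
Import numFieldNormedType.Exports.

Local Open Scope classical_set_scope.
Local Open Scope complex_scope.
Local Open Scope ring_scope.

(* MathComp-Analysis gives R[i] its topology only through the abstract
   numClosedFieldType; these instances expose the same structure, that of the
   complex modulus, on the concrete type. *)
HB.instance Definition _ (R : rcfType) := GRing.ComAlgebra.copy R[i] R[i]^o.
HB.instance Definition _ (R : rcfType) := Vector.copy R[i] R[i]^o.
HB.instance Definition _ (R : rcfType) := NormedModule.copy R[i] R[i]^o.

Section ComplexSpace.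
Variables (R : realType) (n : nat).
Implicit Types (D E K : set 'rV[R[i]]_n) (X : 'rV[R[i]]_n -> 'rV[R[i]]_n).

(* The library norm on 'rV is the max norm: it induces the usual topology on
   C^n, but lengths and balls must be Euclidean, hence the next definitions. *)
Definition enorm (z : 'rV[R[i]]_n) : R :=
  Num.sqrt (\sum_(k < n) Normc.normc (z 0 k) ^+ 2).

Definition eball (p : 'rV[R[i]]_n) (r : R) : set 'rV[R[i]]_n :=
  [set z | enorm (z - p) < r].

Definition eneighborhood K (d : R) : set 'rV[R[i]]_n :=
  [set z | exists2 w, K w & enorm (z - w) < d].

Definition supnorm E X : \bar R := ereal_sup [set (enorm (X z))%:E | z in E].

Definition domain D : Prop := [/\ open D, connected D & D !=set0].

(* Differentiability is taken over the field R[i], i.e. in the complex sense. *)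
Definition holomorphic_on D (f : 'rV[R[i]]_n -> 'rV[R[i]]_n) : Prop :=
  forall z, D z -> differentiable f z.

(* Self-maps of D are represented by total maps whose values off D are
   irrelevant. *)
Definition is_automorphism D (f : 'rV[R[i]]_n -> 'rV[R[i]]_n) : Prop :=
  [/\ holomorphic_on D f, (forall z, D z -> D (f z)) &
      exists h, [/\ holomorphic_on D h, (forall z, D z -> D (h z)),
        (forall z, D z -> h (f z) = z) & (forall z, D z -> f (h z) = z)]].

(* [g t z] stands for g(z, t).  A one-parameter subgroup of the Lie group
   Aut(D) is a continuous homomorphism from R; the topology of Aut(D) is the
   compact-open one, i.e. uniform convergence on the compact subsets of D. *)
Definition one_parameter_action D (g : R -> 'rV[R[i]]_n -> 'rV[R[i]]_n)
    : Prop :=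
  [/\ (forall t, is_automorphism D (g t)),
      (forall z, D z -> g 0 z = z),
      (forall t s z, D z -> g (t + s) z = g s (g t z)) &
      (forall t, {family [set A | compact A /\ A `<=` D],
                  g s @[s --> t] --> g t})].

(* X(z) is the derivative of t |-> g(z, t) at t = 0, written as the limit of
   the difference quotients because C^n is only a module over R[i] here. *)
Definition generates D (g : R -> 'rV[R[i]]_n -> 'rV[R[i]]_n) X : Prop :=
  forall z, D z -> (t^-1)%:C *: (g t z - g 0 z) @[t --> 0^'] --> X z.

End ComplexSpace.

(* Main.v *)
(* The heart of the matter is a local estimate: if [B(p, 16 rho)] lies in [D]
   and [|X| <= A] on [B(p, rho)], then [|X| <= C A] on [B(p, 2 rho)], with [C]
   depending only on [rho], [Rad] and [n].  The flow satisfies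
   [|g_t - id| <= 2 A t] on [B(p, rho / 2)] for [t <= T = delta / A].  As
   [g_t - id] is bounded by [2 Rad], a three-circles argument makes it as small
   as desired on [B(p, 4 rho)], and by Cauchy's estimate it is then
   1/2-Lipschitz at small scale.  In the telescoping sum
   [g_T z - z = \sum_k (g_{k T / N} (g_{T / N} z) - g_{k T / N} z)] each term
   therefore differs from [g_{T / N} z - z] by at most half its norm, so that
   [|X z| <= 2 |g_T z - z| / T], which is linear in [A] because [T = delta / A].
   Connectedness and compactness of [K] spread the estimate from [B(0, s)] to
   [K] with a uniform constant.

   Cauchy's theory is replaced by Goursat's bisection argument applied to
   trapezoidal sums instead of integrals. *)

Require Import Defs.
From HB Require Import structures.
From mathcomp Require Import all_boot all_order all_algebra.
From mathcomp Require Import complex.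
From mathcomp Require Import all_classical all_reals all_analysis.
From mathcomp Require Import ring lra.

Import Order.TTheory GRing.Theory Num.Theory.
Import numFieldNormedType.Exports.

Local Open Scope classical_set_scope.
Local Open Scope complex_scope.
Local Open Scope ring_scope.

Set Implicit Arguments.
Unset Strict Implicit.
Unset Printing Implicit Defensive.

(** * Complex modulus and differentiability *)

Section ComplexModulus.
Variable R : realType.
Implicit Types z w : R[i].

Definition cabs (z : R[i]) : R := Normc.normc z.

Lemma cabs_ge0 z : 0 <= cabs z.
Proof. by case: z => a b; exact: sqrtr_ge0. Qed.

Lemma cabs0 : cabs 0 = 0. Proof. exact: Normc.normc0. Qed.

Lemma cabs1 : cabs 1 = 1. Proof. exact: Normc.normc1. Qed.

Lemma cabsM z w : cabs (z * w) = cabs z * cabs w.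
Proof. exact: Normc.normcM. Qed.

Lemma cabsV z : cabs z^-1 = (cabs z)^-1. Proof. exact: Normc.normcV. Qed.

Lemma cabsN z : cabs (- z) = cabs z. Proof. exact: normcN. Qed.

Lemma cabsBC z w : cabs (z - w) = cabs (w - z).
Proof. by rewrite -cabsN opprB. Qed.

Lemma cabsD z w : cabs (z + w) <= cabs z + cabs w.
Proof. exact: le_normcD. Qed.

Lemma cabsB z w : cabs (z - w) <= cabs z + cabs w.
Proof. by rewrite -(cabsN w) cabsD. Qed.

Lemma cabs_dist z w : cabs z - cabs w <= cabs (z - w).
Proof. by have := cabsD (z - w) w; rewrite subrK; lra. Qed.

Lemma cabs_triangle w z v : cabs (z - v) <= cabs (z - w) + cabs (w - v).
Proof. by rewrite -[z - v](subrKA w) cabsD. Qed.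

Lemma cabs_gt0 z : (0 < cabs z) = (z != 0).
Proof.
rewrite lt_neqAle cabs_ge0 andbT eq_sym; congr (~~ _).
by apply/eqP/eqP => [/Normc.eq0_normc//|->]; rewrite cabs0.
Qed.

Lemma cabs_real (x : R) : cabs x%:C = `|x|.
Proof. by rewrite /cabs /= expr0n /= addr0 sqrtr_sqr. Qed.

Lemma cabs_nat n : cabs n%:R = n%:R.
Proof.
by rewrite -[n%:R in LHS](rmorph_nat (real_complex R)) cabs_real normr_nat.
Qed.

Lemma cabsX z n : cabs (z ^+ n) = cabs z ^+ n.
Proof. by elim: n => [|n IH]; rewrite ?cabs1// !exprS cabsM IH. Qed.

Lemma cabs_half z : cabs (z / 2) = cabs z / 2.
Proof. by rewrite cabsM cabsV cabs_nat. Qed.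

Lemma Re_le_cabs z : `|complex.Re z| <= cabs z.
Proof.
case: z => a b /=; rewrite /cabs /= -sqrtr_sqr ler_sqrt ?lerDl ?sqr_ge0//.
by rewrite addr_ge0 ?sqr_ge0.
Qed.

Lemma Im_le_cabs z : `|complex.Im z| <= cabs z.
Proof.
case: z => a b /=; rewrite /cabs /= -sqrtr_sqr ler_sqrt ?lerDr ?sqr_ge0//.
by rewrite addr_ge0 ?sqr_ge0.
Qed.

Lemma cabs_i : cabs 'i = 1.
Proof. by rewrite /cabs /= expr0n expr1n /= add0r sqrtr1. Qed.

Lemma cabs_le_ReIm z : cabs z <= `|complex.Re z| + `|complex.Im z|.
Proof.
rewrite {1}[z]complexE; apply: (le_trans (cabsD _ _)).
by rewrite cabsM cabs_i mul1r !cabs_real.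
Qed.

(** Bisection evaluates a function only at iterated midpoints of the endpoints, so closure under
    midpoints serves as convexity. *)
Definition midclosed (P : set R[i]) := forall z w, P z -> P w -> P ((z + w) / 2).

Lemma midclosed_disc p (r : R) : midclosed [set z | cabs (z - p) <= r].
Proof.
move=> z w /= hz hw; have -> : (z + w) / 2 - p = (z - p) / 2 + (w - p) / 2 by field.
by have := cabsD ((z - p) / 2) ((w - p) / 2); rewrite !cabs_half; lra.
Qed.

Definition cdiff (f : R[i] -> R[i]) z := exists l, forall e : R, 0 < e ->
  exists2 d : R, 0 < d & forall w, cabs (w - z) < d ->
    cabs (f w - f z - l * (w - z)) <= e * cabs (w - z).

Lemma cdiff_cst c z : cdiff (fun=> c) z.
Proof.
exists 0 => e e0; exists 1 => // w _.
by rewrite mul0r !subrr cabs0 mulr_ge0 ?cabs_ge0// ltW.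
Qed.

Lemma cdiff_affine a b z : cdiff (fun w => a + w * b) z.
Proof.
exists b => e e0; exists 1 => // w _.
have -> : a + w * b - (a + z * b) - b * (w - z) = 0 by ring.
by rewrite cabs0 mulr_ge0 ?cabs_ge0// ltW.
Qed.

Lemma cdiffD f g z : cdiff f z -> cdiff g z -> cdiff (fun w => f w + g w) z.
Proof.
move=> [l Hf] [m Hg]; exists (l + m) => e e0.
have e2 : 0 < e / 2 by lra.
have [d1 d10 H1] := Hf _ e2; have [d2 d20 H2] := Hg _ e2.
exists (Num.min d1 d2); first by rewrite lt_min d10.
move=> w; rewrite lt_min => /andP[/H1 h1 /H2 h2].
have -> : f w + g w - (f z + g z) - (l + m) * (w - z) =
  (f w - f z - l * (w - z)) + (g w - g z - m * (w - z)) by ring.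
by apply: (le_trans (cabsD _ _)); lra.
Qed.

Lemma cdiff_continuous f z : cdiff f z -> forall e : R, 0 < e ->
  exists2 d : R, 0 < d & forall w, cabs (w - z) < d -> cabs (f w - f z) <= e.
Proof.
move=> [l H] e e0; have [d d0 Hd] := H 1 ltr01.
have l0 := cabs_ge0 l.
exists (Num.min d (e / (1 + cabs l))).
  by rewrite lt_min d0 divr_gt0//; lra.
move=> w; rewrite lt_min ltr_pdivlMr; last by lra.
move=> /andP[/Hd h1 h2].
have := cabsD (f w - f z - l * (w - z)) (l * (w - z)).
by rewrite subrK cabsM; lra.
Qed.

Lemma cdiffM f g z : cdiff f z -> cdiff g z -> cdiff (fun w => f w * g w) z.
Proof.
move=> [l Hf] [m Hg]; exists (l * g z + f z * m) => e e0.
have [F0 G0] := (cabs_ge0 (f z), cabs_ge0 (g z)); have [l0 m0] := (cabs_ge0 l, cabs_ge0 m).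
(* [A] collects the coefficients of [e' * cabs h] in the three remainder terms, plus 1 of slack;
   [e' <= 1] enters the bound on [cabs (g w)]. *)
pose A := 1 + cabs (g z) + (1 + cabs m) + cabs l * (1 + cabs m) + cabs (f z).
have lm0 : 0 <= cabs l * (1 + cabs m) by rewrite mulr_ge0//; lra.
have A1 : 0 < A by rewrite /A; lra.
have [e' [e'0 e'1 e'A]] : exists e', [/\ 0 < e', e' <= 1 & e' * A <= e].
  exists (Num.min 1 (e / A)); split; first by rewrite lt_min ltr01 divr_gt0.
    by rewrite ge_min lexx.
  by rewrite -ler_pdivlMr// ge_min lexx orbT.
have [d1 d10 H1] := Hf _ e'0; have [d2 d20 H2] := Hg _ e'0.
exists (Num.min e' (Num.min d1 d2)); first by rewrite !lt_min e'0 d10.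
move=> w; rewrite !lt_min => /and3P[h3 /H1 h1 /H2 h2].
have h0 := cabs_ge0 (w - z); move: h0 h3 h1 h2.
set h := w - z => h0 h3 h1 h2.
have -> : f w * g w - f z * g z - (l * g z + f z * m) * h =
  (f w - f z - l * h) * g w + (l * h * (g w - g z) + f z * (g w - g z - m * h)).
  by rewrite /h; ring.
have dg : cabs (g w - g z) <= (1 + cabs m) * cabs h.
  have := cabsD (g w - g z - m * h) (m * h); rewrite subrK cabsM.
  have eh : e' * cabs h <= 1 * cabs h by rewrite ler_wpM2r.
  by lra.
have dg1 : (1 + cabs m) * cabs h <= (1 + cabs m) * e' by rewrite ler_wpM2l; lra.
have dg2 : (1 + cabs m) * e' <= (1 + cabs m) * 1 by rewrite ler_wpM2l; lra.
have gw : cabs (g w) <= cabs (g z) + (1 + cabs m).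
  by have := cabs_dist (g w) (g z); lra.
apply: (le_trans (cabsD _ _)); apply: (le_trans (lerD (lexx _) (cabsD _ _))).
rewrite !cabsM.
have eh0 : 0 <= e' * cabs h by rewrite mulr_ge0// ltW.
have a1 := ler_pM (cabs_ge0 _) (cabs_ge0 _) h1 gw.
have lh0 : 0 <= cabs l * cabs h by rewrite mulr_ge0.
have a2 := ler_wpM2l lh0 (le_trans dg dg1).
have a3 := ler_wpM2l F0 h2.
have a4 : e' * A * cabs h <= e * cabs h by rewrite ler_wpM2r.
rewrite /A in a4.
have E : cabs l * cabs h * ((1 + cabs m) * e') =
  e' * (cabs l * (1 + cabs m)) * cabs h by ring.
rewrite E in a2; apply: le_trans a4.
have E4 : e' * (1 + cabs (g z) + (1 + cabs m) + cabs l * (1 + cabs m) + cabs (f z)) * cabs h =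
  e' * cabs h * (cabs (g z) + (1 + cabs m)) + e' * (cabs l * (1 + cabs m)) * cabs h
  + cabs (f z) * (e' * cabs h) + e' * cabs h by ring.
by rewrite E4; lra.
Qed.

Lemma cdiffV c z : z != c -> cdiff (fun w => (w - c)^-1) z.
Proof.
move=> zc; exists (- (z - c)^-2) => e e0.
have a0 : 0 < cabs (z - c) by rewrite cabs_gt0 subr_eq0.
set a := cabs (z - c) in a0.
have ea : 0 < e * a ^+ 3 / 2 by rewrite divr_gt0 ?mulr_gt0 ?exprn_gt0.
(* The first bound keeps [w] at distance at least [a / 2] from [c]; the second then makes
   [cabs (w - z)] over [cabs (w - c) * a ^+ 2] at most [e]. *)
exists (Num.min (a / 2) (e * a ^+ 3 / 2)); first by rewrite lt_min ea divr_gt0.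
move=> w; rewrite lt_min => /andP[h1 h2].
have h3 : a / 2 <= cabs (w - c).
  by have := cabs_triangle w z c; rewrite (cabsBC z w) -/a; lra.
have wc : w - c != 0 by rewrite -cabs_gt0; apply: lt_le_trans h3; rewrite divr_gt0.
have zc' : z - c != 0 by rewrite subr_eq0.
have -> : (w - c)^-1 - (z - c)^-1 - - (z - c)^-2 * (w - z) =
  (w - z) * (w - z) / ((w - c) * (z - c) ^+ 2) by field; rewrite zc' wc.
rewrite !cabsM cabsV cabsM cabsX -/a -mulrA mulrC ler_wpM2r ?cabs_ge0//.
rewrite ler_pdivrMr; last by rewrite mulr_gt0 ?exprn_gt0//; lra.
apply: (le_trans (ltW h2)).
have -> : e * a ^+ 3 / 2 = e * (a / 2 * a ^+ 2) by field.
by rewrite ler_wpM2l ?ler_wpM2r ?exprn_ge0// ltW.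
Qed.

Lemma cdiffVn c z n : z != c -> cdiff (fun w => (w - c) ^- n) z.
Proof.
move=> zc; elim: n => [|n IH].
  have -> : (fun w => (w - c) ^- 0) = (fun=> 1) by apply/funext => w; rewrite expr0 invr1.
  exact: cdiff_cst.
have -> : (fun w => (w - c) ^- n.+1) = (fun w => (w - c)^-1 * (w - c) ^- n).
  by apply/funext => w; rewrite exprS invfM.
by apply: cdiffM => //; exact: cdiffV.
Qed.

End ComplexModulus.

(** * Goursat's theorem *)

Section Goursat.
Variable R : realType.
Implicit Types (f : R[i] -> R[i]) (a b c z w : R[i]).

(* Trapezoidal sum of [f dz] on [a, b] cut into [2 ^ m] equal pieces.  Being
   exactly additive under bisection, these sums replace integrals: identities
   between integrals become estimates for all large [m] with arbitrarily small
   error. *)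
Fixpoint seg (m : nat) f a b : R[i] :=
  if m is m'.+1 then seg m' f a ((a + b) / 2) + seg m' f ((a + b) / 2) b
  else (f a + f b) / 2 * (b - a).

Lemma seg_rev m f a b : seg m f b a = - seg m f a b.
Proof.
elim: m a b => [|m IH] a b /=; first by ring.
by rewrite (addrC b a) (IH ((a + b) / 2) b) (IH a); ring.
Qed.

Lemma segD m f g a b : seg m (fun z => f z + g z) a b = seg m f a b + seg m g a b.
Proof.
elim: m a b => [|m IH] a b /=; first by field.
by rewrite !IH; ring.
Qed.

Lemma segZ m k f a b : seg m (fun z => k * f z) a b = k * seg m f a b.
Proof.
elim: m a b => [|m IH] a b /=; first by field.
by rewrite !IH; ring.
Qed.

(** The trapezoidal rule is exact on affine functions, so their sums around a closed polygon vanish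
    for every [m]. *)
Lemma seg_affine m k l a b :
  seg m (fun z => k + l * z) a b = k * (b - a) + l * (b ^+ 2 - a ^+ 2) / 2.
Proof.
elim: m a b => [|m IH] a b /=; first by field.
by rewrite !IH; field.
Qed.

Lemma eq_seg (P : set R[i]) m f g a b : midclosed P -> P a -> P b ->
  (forall z, P z -> f z = g z) -> seg m f a b = seg m g a b.
Proof.
move=> mP + + fg; elim: m a b => [|m IH] a b Pa Pb /=; first by rewrite !fg.
by rewrite !IH//; exact: mP.
Qed.

Lemma seg_le (P : set R[i]) m f a b (M : R) : midclosed P -> P a -> P b ->
  (forall z, P z -> cabs (f z) <= M) -> cabs (seg m f a b) <= M * cabs (b - a).
Proof.
move=> mP + + fM; elim: m a b => [|m IH] a b Pa Pb /=.
  rewrite cabsM ler_wpM2r ?cabs_ge0// cabs_half.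
  by have := cabsD (f a) (f b); have := fM _ Pa; have := fM _ Pb; lra.
have Pc := mP _ _ Pa Pb; apply: (le_trans (cabsD _ _)).
have := IH _ _ Pa Pc; have := IH _ _ Pc Pb.
have -> : (a + b) / 2 - a = (b - a) / 2 by field.
have -> : b - (a + b) / 2 = (b - a) / 2 by field.
by rewrite cabs_half; lra.
Qed.

Lemma Im_half z : complex.Im (z / 2) = complex.Im z / 2.
Proof.
have {2}-> : z = z / 2 + z / 2 by field.
by rewrite raddfD /=; field.
Qed.

(** Halving the segment halves [b - a] and hence the pointwise bound, and the two halves add up
    again. This yields the lower bound on [winding]. *)
Lemma seg_Im_ge (P : set R[i]) m f a b (k : R) : midclosed P -> P a -> P b ->
  (forall z, P z -> k <= complex.Im (f z * (b - a))) -> k <= complex.Im (seg m f a b).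
Proof.
move=> mP; elim: m a b k => [|m IH] a b k Pa Pb /= H.
  have -> : (f a + f b) / 2 * (b - a) = (f a * (b - a) + f b * (b - a)) / 2 by field.
  by have := H _ Pa; have := H _ Pb; rewrite Im_half raddfD /=; lra.
have Pc := mP _ _ Pa Pb.
have h1 : k / 2 <= complex.Im (seg m f a ((a + b) / 2)).
  apply: IH => // z Pz; have -> : (a + b) / 2 - a = (b - a) / 2 by field.
  by rewrite mulrA Im_half ler_pM2r// H.
have h2 : k / 2 <= complex.Im (seg m f ((a + b) / 2) b).
  apply: IH => // z Pz; have -> : b - (a + b) / 2 = (b - a) / 2 by field.
  by rewrite mulrA Im_half ler_pM2r// H.
by rewrite raddfD /=; lra.
Qed.

Lemma seg_scale m f a b w (k : R[i]) :
  seg m f (w + k * a) (w + k * b) = seg m (fun z => k * f (w + k * z)) a b.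
Proof.
elim: m a b => [|m IH] a b /=; first by field.
have -> : (w + k * a + (w + k * b)) / 2 = w + k * ((a + b) / 2) by field.
by rewrite !IH.
Qed.

Definition tri m f (t : R[i] * R[i] * R[i]) : R[i] :=
  seg m f t.1.1 t.1.2 + seg m f t.1.2 t.2 + seg m f t.2 t.1.1.

(** The midpoints of the sides cut the triangle into four; each inner edge is run through once in
    each direction and cancels by [seg_rev]. *)
Lemma triS m f a b c : tri m.+1 f (a, b, c) =
  tri m f (a, (a + b) / 2, (c + a) / 2) + tri m f ((a + b) / 2, b, (b + c) / 2)
  + tri m f ((c + a) / 2, (b + c) / 2, c)
  + tri m f ((b + c) / 2, (c + a) / 2, (a + b) / 2).
Proof.
rewrite /tri /= (seg_rev _ _ ((a + b) / 2) ((c + a) / 2)).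
rewrite (seg_rev _ _ ((b + c) / 2) ((a + b) / 2)).
by rewrite (seg_rev _ _ ((c + a) / 2) ((b + c) / 2)); ring.
Qed.

(** The tail of the geometric series is [2 * L / 2 ^+ k], so the intervals of that radius around
    [x k] are nested; the limit is the supremum of their left ends. *)
Lemma real_cauchy_geom (x : nat -> R) (L : R) :
  (forall k, `|x k.+1 - x k| <= L / 2 ^+ k) ->
  exists l, forall k, `|x k - l| <= 2 * L / 2 ^+ k.
Proof.
move=> H; have [q qE] : exists q : nat -> R, forall k, q k = 2 * L / 2 ^+ k by exists (fun k => 2 * L / 2 ^+ k).
have qS k : q k = q k.+1 + L / 2 ^+ k.
  by rewrite !qE exprS invfM; field; rewrite expf_neq0.
have L0 k : 0 <= L / 2 ^+ k by apply: le_trans (H k).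
have q0 k : 0 <= q k by rewrite qE -mulrA mulr_ge0.
have lo k j : x k - q k <= x (k + j)%N - q (k + j)%N.
  elim: j => [|j IH]; first by rewrite addn0.
  rewrite addnS; apply: (le_trans IH).
  by have := H (k + j)%N; rewrite ler_norml qS; lra.
have up k j : x (k + j)%N + q (k + j)%N <= x k + q k.
  elim: j => [|j IH]; first by rewrite addn0.
  rewrite addnS; apply: le_trans IH.
  by have := H (k + j)%N; rewrite ler_norml (qS (k + j)%N); lra.
have cross k j : x k - q k <= x j + q j.
  have h1 := lo k j; have h2 := up j k; have h3 := q0 (k + j)%N.
  by rewrite addnC in h2; lra.
pose A := [set x k - q k | k in [set: nat]].
have A0 : A !=set0 by exists (x 0%N - q 0%N), 0%N.
exists (sup A) => k; rewrite ler_norml.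
have h1 : x k - q k <= sup A.
  by apply: sup_upper_bound; [split=> //; exists (x 0%N + q 0%N) => _ [j _ <-] | exists k].
have h2 : sup A <= x k + q k by apply: ge_sup => // _ [j _ <-].
by rewrite -qE; lra.
Qed.

Lemma complex_cauchy_geom (z : nat -> R[i]) (L : R) :
  (forall k, cabs (z k.+1 - z k) <= L / 2 ^+ k) ->
  exists l, forall k, cabs (z k - l) <= 4 * L / 2 ^+ k.
Proof.
move=> H.
have [|x hx] := @real_cauchy_geom (fun k => complex.Re (z k)) L.
  by move=> k; rewrite -raddfB; exact: le_trans (Re_le_cabs _) (H k).
have [|y hy] := @real_cauchy_geom (fun k => complex.Im (z k)) L.
  by move=> k; rewrite -raddfB; exact: le_trans (Im_le_cabs _) (H k).
exists (x +i* y) => k; apply: (le_trans (cabs_le_ReIm _)).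
have := hx k; have := hy k; rewrite !raddfB /=.
have -> : 4 * L / 2 ^+ k = 2 * L / 2 ^+ k + 2 * L / 2 ^+ k by field; rewrite expf_neq0.
lra.
Qed.

Lemma geometric_small (A d : R) : 0 < d -> exists k, A / 2 ^+ k <= d.
Proof.
move=> d0; exists (Num.Def.archi_bound (A / d)).
rewrite ler_pdivrMr ?exprn_gt0// mulrC -ler_pdivrMr//.
by apply: ltW; exact: upper_nthrootP.
Qed.

(** Stands for a bound on the modulus of an integral of which the [u m] are approximations; it
    asserts no convergence. *)
Definition eventually_le (u : nat -> R[i]) (e : R) :=
  exists m0, forall m, (m0 <= m)%N -> cabs (u m) <= e.

Lemma eventually_leD u v e1 e2 : eventually_le u e1 -> eventually_le v e2 ->
  eventually_le (fun m => u m + v m) (e1 + e2).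
Proof.
move=> [m1 h1] [m2 h2]; exists (maxn m1 m2) => m; rewrite geq_max => /andP[/h1 a /h2 b].
by apply: (le_trans (cabsD _ _)); lra.
Qed.

Lemma eventually_leS u e : eventually_le (fun m => u m.+1) e -> eventually_le u e.
Proof. by move=> [m0 h]; exists m0.+1 => -[//|m]; exact: h. Qed.

Definition limit_closed (P : set R[i]) :=
  forall z, (forall e : R, 0 < e -> exists2 w, P w & cabs (w - z) <= e) -> P z.

Lemma limit_closed_disc p (r : R) : limit_closed [set z | cabs (z - p) <= r].
Proof.
move=> z H /=; apply/ler_addgt0Pr => e /H[w /= wr we].
by have := cabs_triangle w z p; rewrite (cabsBC z w); lra.
Qed.

(** If the sums around a triangle fail to get below [e / 4 ^+ k], those around one of its quarters
    fail to get below [e / 4 ^+ k.+1]. The successive triangles shrink to a point [z0] of [P], near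
    which [f] is affine up to a small multiple of the distance; the affine part contributes nothing,
    and the rest is of order [4 ^- k] with as small a factor as desired. *)
Lemma goursat (P : set R[i]) f a b c : midclosed P -> limit_closed P ->
  (forall z, P z -> cdiff f z) -> P a -> P b -> P c ->
  forall e : R, 0 < e -> eventually_le (fun m => tri m f (a, b, c)) e.
Proof.
move=> mP cP df Pa Pb Pc e e0; apply: contrapT => Hbad.
pose L := cabs (b - a) + cabs (c - b) + cabs (a - c) + 1.
have [ba0 cb0 ac0] := (And3 (cabs_ge0 (b - a)) (cabs_ge0 (c - b)) (cabs_ge0 (a - c))).
have L0 : 0 < L by rewrite /L; lra.
pose bad k (t : R[i] * R[i] * R[i]) := [/\ [/\ P t.1.1, P t.1.2 & P t.2],
  [/\ cabs (t.1.2 - t.1.1) <= L / 2 ^+ k, cabs (t.2 - t.1.2) <= L / 2 ^+ k &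
      cabs (t.1.1 - t.2) <= L / 2 ^+ k] &
  ~ eventually_le (fun m => tri m f t) (e / 4 ^+ k)].
have step (kt : nat * (R[i] * R[i] * R[i])) : exists t', bad kt.1 kt.2 ->
    bad kt.1.+1 t' /\ cabs (t'.1.1 - kt.2.1.1) <= L / 2 ^+ kt.1.
  case: kt => k [[x y] z] /=; apply: contrapT => /forallNP no.
  have B : bad k (x, y, z) by have /not_implyP[] := no (x, y, z).
  have [/= [Px Py Pz] [xy yz zx] nb] := B.
  have half (u v : R[i]) : cabs (u - v) <= L / 2 ^+ k ->
      cabs ((u - v) / 2) <= L / 2 ^+ k.+1.
    by rewrite cabs_half exprSr invfM mulrA => h; rewrite ler_pM2r.
  have full (u v : R[i]) : cabs (u - v) <= L / 2 ^+ k ->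
      cabs ((u - v) / 2) <= L / 2 ^+ k.
    by have := cabs_ge0 (u - v); rewrite cabs_half; lra.
  have [Pxy Pyz Pzx] := And3 (mP _ _ Px Py) (mP _ _ Py Pz) (mP _ _ Pz Px).
  have good t' : [/\ P t'.1.1, P t'.1.2 & P t'.2] ->
      [/\ cabs (t'.1.2 - t'.1.1) <= L / 2 ^+ k.+1, cabs (t'.2 - t'.1.2) <= L / 2 ^+ k.+1 &
      cabs (t'.1.1 - t'.2) <= L / 2 ^+ k.+1] -> cabs (t'.1.1 - x) <= L / 2 ^+ k ->
      eventually_le (fun m => tri m f t') (e / 4 ^+ k.+1).
    move=> h1 h2 h3; apply: contrapT => h4.
    by apply: (no t') => _; split => //; split.
  (* Cutting the triangle uses up one level of bisection; the shift of [m] does not affect a bound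
     for large [m]. *)
  apply: nb; apply: eventually_leS.
  have -> : e / 4 ^+ k = e / 4 ^+ k.+1 + e / 4 ^+ k.+1 + e / 4 ^+ k.+1 + e / 4 ^+ k.+1.
    by rewrite exprS invfM; field; rewrite expf_neq0.
  rewrite (_ : (fun m => tri m.+1 f (x, y, z)) = (fun m => 
    tri m f (x, (x + y) / 2, (z + x) / 2) + tri m f ((x + y) / 2, y, (y + z) / 2)
  + tri m f ((z + x) / 2, (y + z) / 2, z)
  + tri m f ((y + z) / 2, (z + x) / 2, (x + y) / 2))); last first.
    by apply/funext => m; rewrite triS.
  have yx : cabs (x - y) <= L / 2 ^+ k by rewrite cabsBC.
  have zy : cabs (y - z) <= L / 2 ^+ k by rewrite cabsBC.
  have xz : cabs (z - x) <= L / 2 ^+ k by rewrite cabsBC.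
  have e1 (u v : R[i]) : (u + v) / 2 - u = (v - u) / 2 by field.
  have e2 (u v : R[i]) : u - (u + v) / 2 = (u - v) / 2 by field.
  have e3 (u v : R[i]) : (u + v) / 2 - v = (u - v) / 2 by field.
  have e4 (u v : R[i]) : v - (u + v) / 2 = (v - u) / 2 by field.
  have e5 (u v w : R[i]) : (u + v) / 2 - (v + w) / 2 = (u - w) / 2 by field.
  have e6 (u v w : R[i]) : (v + w) / 2 - (u + v) / 2 = (w - u) / 2 by field.
  apply: eventually_leD; [apply: eventually_leD; [apply: eventually_leD|]|];
    apply: good => /=; try (split => //);
    rewrite ?(e1, e2, e3, e4, e5, e6); try exact: half; try exact: full.
  - by rewrite subrr cabs0 divr_ge0 ?exprn_ge0// ltW.
  - have -> : (y + z) / 2 - x = (y - x) / 2 + (z - x) / 2 by field.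
    by apply: (le_trans (cabsD _ _)); rewrite !cabs_half; lra.
have [F HF] := choice step.
pose t := fix t k := if k is k'.+1 then F (k', t k') else (a, b, c).
have tb k : bad k (t k).
  elim: k => [|k IH].
    split => //=; first by split; rewrite expr0 divr1 /L; lra.
    by rewrite expr0 divr1.
  by have [] := HF (k, t k) IH.
have [|z0 hz0] := @complex_cauchy_geom (fun k => (t k).1.1) L.
  by move=> k; have [] := HF (k, t k) (tb k).
have Pz0 : P z0.
  apply: cP => d d0; have [k hk] := geometric_small (4 * L) d0.
  by exists (t k).1.1; [have [[]] := tb k | exact: le_trans (hz0 k) hk].
have [l Hl] := df _ Pz0.
(* Three sides of length at most [L / 2 ^+ k], on which the remainder is at most [e' * r] with
   [r = 5 * L / 2 ^+ k], give [15 * e' * L ^+ 2 / 4 ^+ k] in all. *)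
pose e' := e / (15 * L ^+ 2).
have e'0 : 0 < e' by rewrite divr_gt0// mulr_gt0// exprn_gt0.
have [d d0 Hd] := Hl _ e'0.
have [k hk] := geometric_small (10 * L) d0.
(* The first vertex is within [4 * L / 2 ^+ k] of [z0], and a side adds [L / 2 ^+ k]. *)
pose r := 5 * L / 2 ^+ k.
have r0 : 0 < r by rewrite /r divr_gt0 ?exprn_gt0 ?mulr_gt0.
have rd : r < d.
  have E : 10 * L / 2 ^+ k = r + r by rewrite /r; field; rewrite expf_neq0.
  by rewrite E in hk; lra.
have [[Pt1 Pt2 Pt3] [s1 s2 s3] nb] := tb k.
apply: nb; exists 0%N => m _.
pose D := [set z | cabs (z - z0) <= r].
have r45 : r = 4 * L / 2 ^+ k + L / 2 ^+ k by rewrite /r; field; rewrite expf_neq0.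
have hk0 := hz0 k.
have D1 : D (t k).1.1 by rewrite /D /= r45; have := cabs_ge0 ((t k).1.2 - (t k).1.1); lra.
have D2 : D (t k).1.2.
  by rewrite /D /= r45; have := cabs_triangle (t k).1.1 (t k).1.2 z0; lra.
have D3 : D (t k).2.
  by rewrite /D /= r45; have := cabs_triangle (t k).1.1 (t k).2 z0; rewrite (cabsBC (t k).2 (t k).1.1); lra.
pose g z := f z - f z0 - l * (z - z0).
have gD z : D z -> cabs (g z) <= e' * r.
  move=> Dz; apply: (le_trans (Hd _ (le_lt_trans Dz rd))).
  by rewrite ler_pM2l.
have sg u v : D u -> D v -> cabs (v - u) <= L / 2 ^+ k ->
    cabs (seg m g u v) <= e' * r * (L / 2 ^+ k).
  move=> Du Dv uv.
  apply: (le_trans (seg_le _ (@midclosed_disc _ z0 r) Du Dv gD)).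
  by rewrite ler_wpM2l// mulr_ge0// ltW.
have fE : f = (fun z => g z + ((f z0 - l * z0) + l * z)).
  by apply/funext => z; rewrite /g; ring.
have -> : tri m f (t k) = seg m g (t k).1.1 (t k).1.2 + seg m g (t k).1.2 (t k).2
   + seg m g (t k).2 (t k).1.1.
  have segE u v : seg m f u v = seg m g u v
      + ((f z0 - l * z0) * (v - u) + l * (v ^+ 2 - u ^+ 2) / 2).
    by rewrite {1}fE segD seg_affine.
  by rewrite /tri !segE; field.
apply: (le_trans (cabsD _ _)); apply: (le_trans (lerD (cabsD _ _) (lexx _))).
have -> : e / 4 ^+ k = e' * r * (L / 2 ^+ k) + e' * r * (L / 2 ^+ k) + e' * r * (L / 2 ^+ k).
  have -> : 4 ^+ k = 2 ^+ k * 2 ^+ k :> R.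
    by rewrite -exprMn; congr (_ ^+ _); ring.
  rewrite /e' /r; field.
  by rewrite expf_neq0// gt_eqF.
have := sg _ _ D1 D2 s1; have := sg _ _ D2 D3 s2; have := sg _ _ D3 D1 s3.
lra.
Qed.

End Goursat.

(** * Cauchy's formula *)

Section Cauchy.
Variable R : realType.
Implicit Types (f g F : R[i] -> R[i]) (p u w z : R[i]) (d r : R).

(** One side of the square with centre [p] and half side [d], run counterclockwise; [u] is a unit
    and [u * 'i] the outward normal, so that [u = 1] is the top side. *)
Definition side m F p d u : R[i] :=
  seg m F (p + d%:C * (u * (1 + 'i))) (p + d%:C * (u * (-1 + 'i))).

Definition sq m F p d : R[i] :=
  side m F p d 1 + side m F p d 'i + side m F p d (-1) + side m F p d (- 'i).

(** For a unit [u], the part of a disc beyond the line at distance [d] from [w] in the direction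
    [u * 'i]: a convex set that misses [w] when [d > 0]. *)
Definition cap p r w d u :=
  [set z | cabs (z - p) <= r /\ d <= complex.Im ((z - w) / u)].

Lemma midclosed_cap p r w d u : midclosed (cap p r w d u).
Proof.
move=> x y [x1 x2] [y1 y2]; split; first exact: (midclosed_disc x1 y1).
have -> : ((x + y) / 2 - w) / u = ((x - w) / u + (y - w) / u) / 2.
  have -> : (x + y) / 2 - w = ((x - w) + (y - w)) / 2 by field.
  by rewrite mulrAC mulrDl.
by rewrite Im_half raddfD /=; lra.
Qed.

Lemma limit_closed_cap p r w d u : cabs u = 1 -> limit_closed (cap p r w d u).
Proof.
move=> u1 z H; split.
  by apply: limit_closed_disc => e /H[x [x1 _] x2]; exists x.
apply/ler_addgt0Pr => e /H[x [_ x1] x2].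
have := Im_le_cabs ((x - z) / u); rewrite cabsM cabsV u1 invr1 mulr1 ler_norml.
have -> : (x - z) / u = (x - w) / u - (z - w) / u by ring.
by rewrite raddfB /=; lra.
Qed.

Lemma cap_dist p r w d u z : cabs u = 1 -> cap p r w d u z -> d <= cabs (z - w).
Proof.
move=> u1 [_ zd]; have := Im_le_cabs ((z - w) / u).
by rewrite cabsM cabsV u1 invr1 mulr1 ler_norml; lra.
Qed.

Lemma cabs_diag : (cabs (1 + 'i : R[i]) <= 2) * (cabs (-1 + 'i : R[i]) <= 2).
Proof.
split; apply: (le_trans (cabsD _ _)); rewrite ?cabsN cabs1 cabs_i; lra.
Qed.

Lemma cap_corner p r w d e u (c : R[i]) : cabs u = 1 -> 0 <= e ->
  c = 1 + 'i \/ c = -1 + 'i -> cabs (w - p) + 2 * e <= r ->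
  d <= e -> cap p r w d u (w + e%:C * (u * c)).
Proof.
move=> u1 e0 hc wr de; split.
  have -> : w + e%:C * (u * c) - p = (w - p) + e%:C * (u * c) by ring.
  apply: (le_trans (cabsD _ _)); rewrite !cabsM u1 mul1r cabs_real ger0_norm//.
  apply: le_trans wr; rewrite lerD2l mulrC ler_wpM2r//.
  by case: hc => ->; rewrite cabs_diag.
have u0 : u != 0 by rewrite -cabs_gt0 u1.
have -> : (w + e%:C * (u * c) - w) / u = e%:C * c by field.
by case: hc => -> /=; rewrite !(mul0r, mulr0, addr0, add0r, mulr1) /=; lra.
Qed.

Lemma cap_corner_shift p r w d e u (c : R[i]) : cabs u = 1 -> 0 <= e ->
  c = 1 + 'i \/ c = -1 + 'i -> 2 * e <= r ->
  cabs (w - p) + d <= e -> cap p r w d u (p + e%:C * (u * c)).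
Proof.
move=> u1 e0 hc er de.
have [|h1 h2] := @cap_corner p r p e e u c u1 e0 hc _ (lexx _).
  by rewrite subrr cabs0 add0r.
split=> //; have -> : (p + e%:C * (u * c) - w) / u =
  (p + e%:C * (u * c) - p) / u - (w - p) / u by ring.
rewrite raddfB /=; have := Im_le_cabs ((w - p) / u).
by rewrite cabsM cabsV u1 invr1 mulr1 ler_norml; lra.
Qed.

Lemma cap_ends p d u : cabs u = 1 -> 0 <= d ->
  cap p (2 * d) p d u (p + d%:C * (u * (1 + 'i))) /\
  cap p (2 * d) p d u (p + d%:C * (u * (-1 + 'i))).
Proof.
by move=> u1 d0; split; apply: cap_corner => //; rewrite ?subrr ?cabs0 ?add0r; auto.
Qed.

(** The side has length [2 * d], and its points are at distance between [d] and [sqrt 2 * d] from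
    [p]; the latter is rounded up to [2 * d]. *)
Lemma side_le m F p d u (M : R) : cabs u = 1 -> 0 <= d ->
  (forall z, d <= cabs (z - p) <= 2 * d -> cabs (F z) <= M) ->
  cabs (side m F p d u) <= 2 * d * M.
Proof.
move=> u1 d0 FM; have [c1 c2] := cap_ends p u1 d0.
apply: (le_trans (seg_le _ (@midclosed_cap p (2 * d) p d u) c1 c2 (M := M) _)).
  by move=> z hz; apply: FM; rewrite (cap_dist u1 hz) (proj1 hz).
have -> : p + d%:C * (u * (-1 + 'i)) - (p + d%:C * (u * (1 + 'i))) =
  - (2 * (d%:C * u)) by ring.
by rewrite cabsN !cabsM cabs_nat u1 mulr1 cabs_real ger0_norm// mulrC.
Qed.

Lemma cabs_units : [/\ cabs (1 : R[i]) = 1, cabs ('i : R[i]) = 1,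
  cabs (-1 : R[i]) = 1 & cabs (- 'i : R[i]) = 1].
Proof. by rewrite !cabsN cabs1 cabs_i. Qed.

Lemma sq_le m F p d (M : R) : 0 <= d ->
  (forall z, d <= cabs (z - p) <= 2 * d -> cabs (F z) <= M) ->
  cabs (sq m F p d) <= 8 * d * M.
Proof.
move=> d0 FM; have [u1 u2 u3 u4] := cabs_units.
apply: (le_trans (cabsD _ _)); apply: (le_trans (lerD (cabsD _ _) (lexx _))).
apply: (le_trans (lerD (lerD (cabsD _ _) (lexx _)) (lexx _))).
have := side_le m u1 d0 FM; have := side_le m u2 d0 FM.
by have := side_le m u3 d0 FM; have := side_le m u4 d0 FM; lra.
Qed.

Lemma eq_sq m F G p d : 0 <= d ->
  (forall z, d <= cabs (z - p) <= 2 * d -> F z = G z) -> sq m F p d = sq m G p d.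
Proof.
move=> d0 FG; have [u1 u2 u3 u4] := cabs_units.
have sideE u : cabs u = 1 -> side m F p d u = side m G p d u.
  move=> cu; have [c1 c2] := cap_ends p cu d0.
  apply: (eq_seg _ (@midclosed_cap p (2 * d) p d u) c1 c2) => z hz.
  by apply: FG; rewrite (cap_dist cu hz) (proj1 hz).
by rewrite /sq !sideE.
Qed.

Lemma sqD m f g p d : sq m (fun z => f z + g z) p d = sq m f p d + sq m g p d.
Proof. by rewrite /sq /side !segD; ring. Qed.

Lemma sqZ m k f p d : sq m (fun z => k * f z) p d = k * sq m f p d.
Proof. by rewrite /sq /side !segZ; ring. Qed.

(* The region between the two squares is cut into four trapezoids, along the
   segments joining corresponding corners. *)
Lemma sq_deform F w d r : 0 < r -> cabs w + r <= d ->
  (forall z, cabs z <= 2 * d -> z != w -> cdiff F z) ->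
  forall e : R, 0 < e -> eventually_le (fun m => sq m F 0 d - sq m F w r) e.
Proof.
move=> r0 wd dF e e0; have [u1 u2 u3 u4] := cabs_units.
have w0 := cabs_ge0 w.
pose spoke m c := seg m F (0 + d%:C * c) (w + r%:C * c).
(* The trapezoid over the side [u] lies in a cap that misses [w]. A diagonal cuts it into two
   triangles for [goursat], and the two passages along the diagonal cancel. *)
have trap u : cabs u = 1 -> eventually_le (fun m => side m F 0 d u
    + (spoke m (u * (-1 + 'i)) - side m F w r u - spoke m (u * (1 + 'i)))) (e / 4).
  move=> cu.
  have du z : cap 0 (2 * d) w r u z -> cdiff F z.
    move=> hz; apply: dF; first by have := proj1 hz; rewrite subr0.
    have := cap_dist cu hz; rewrite -subr_eq0 -cabs_gt0; lra.
  have gr := goursat (@midclosed_cap 0 (2 * d) w r u)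
    (@limit_closed_cap 0 (2 * d) w r u cu) du.
  have cc c : c = 1 + 'i \/ c = -1 + 'i ->
      cap 0 (2 * d) w r u (0 + d%:C * (u * c)) /\
      cap 0 (2 * d) w r u (w + r%:C * (u * c)).
    move=> hc; split; first by apply: cap_corner_shift => //; rewrite ?subr0; lra.
    by apply: cap_corner => //; rewrite ?subr0; lra.
  have [A D] := cc (1 + 'i) (or_introl erefl).
  have [B C] := cc (-1 + 'i) (or_intror erefl).
  have e8 : 0 < e / 8 by lra.
  have -> : e / 4 = e / 8 + e / 8 by field.
  have := eventually_leD (gr _ _ _ A B C _ e8) (gr _ _ _ A C D _ e8).
  congr (eventually_le _ _); apply/funext => m.
  rewrite /tri /spoke /side /=.
  rewrite (seg_rev _ _ (0 + d%:C * (u * (1 + 'i))) (w + r%:C * (u * (-1 + 'i)))).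
  rewrite (seg_rev _ _ (0 + d%:C * (u * (1 + 'i))) (w + r%:C * (u * (1 + 'i)))).
  rewrite (seg_rev _ _ (w + r%:C * (u * (1 + 'i))) (w + r%:C * (u * (-1 + 'i)))).
  by ring.
have := eventually_leD (eventually_leD (eventually_leD (trap _ u1) (trap _ u2)) (trap _ u3)) (trap _ u4).
have -> : e / 4 + e / 4 + e / 4 + e / 4 = e by field.
congr (eventually_le _ _); apply/funext => m.
(* The end of the side [u] is the start of the side ['i * u], so each spoke occurs twice with
   opposite signs. *)
have ii : 'i * 'i = -1 :> R[i] by rewrite -expr2 sqr_i.
have -> : 1 * (-1 + 'i) = 'i * (1 + 'i) :> R[i] by rewrite !mulrDr ii; ring.
have -> : 'i * (-1 + 'i) = -1 * (1 + 'i) :> R[i] by rewrite !mulrDr ii; ring.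
have -> : -1 * (-1 + 'i) = - 'i * (1 + 'i) :> R[i] by rewrite !mulrDr !mulNr ii; ring.
have -> : - 'i * (-1 + 'i) = 1 * (1 + 'i) :> R[i] by rewrite !mulrDr !mulNr ii; ring.
by rewrite /sq; ring.
Qed.

(* A trapezoidal approximation of [\oint dz / z = 2 * pi * i]; only its being
   bounded away from 0 matters. *)
Definition winding m : R[i] := sq m (fun z => z^-1) 0 1.

(** On the side [u] one has [z = u * (x + 'i)] with [x] in [-1, 1], and the increment is [- 2 * u];
    so the imaginary part of dz / z is [2 / (x ^+ 2 + 1)], at least 1, and the four sides add up. *)
Lemma winding_ge m : 4 <= cabs (winding m).
Proof.
have [u1 u2 u3 u4] := cabs_units.
have side1 u : cabs u = 1 -> 1 <= complex.Im (side m (fun z => z^-1) 0 1 u).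
  move=> cu; have u0 : u != 0 by rewrite -cabs_gt0 cu.
  pose P := [set z : R[i] | `|complex.Re (z / u)| <= 1 /\ complex.Im (z / u) = 1].
  apply: (@seg_Im_ge _ P).
  - move=> x y [x1 x2] [y1 y2].
    have E : (x + y) / 2 / u = (x / u + y / u) / 2 by rewrite mulrAC mulrDl.
    have hRe (z : R[i]) : complex.Re (z / 2) = complex.Re z / 2.
      have {2}-> : z = z / 2 + z / 2 by field.
      by rewrite raddfD /=; field.
    split; rewrite E ?hRe ?Im_half raddfD /=; last by rewrite x2 y2; field.
    by move: x1 y1; rewrite !ler_norml; lra.
  - have E : (0 + 1%:C * (u * (1 + 'i))) / u = 1 + 'i by field.
    by split; rewrite E /= ?addr0 ?add0r ?normr1.
  - have E : (0 + 1%:C * (u * (-1 + 'i))) / u = -1 + 'i by field.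
    by split; rewrite E /= ?addr0 ?oppr0 ?add0r ?normrN ?normr1.
  - move=> z [z1 z2].
    have E : z^-1 * (0 + 1%:C * (u * (-1 + 'i)) - (0 + 1%:C * (u * (1 + 'i)))) =
       - ((z / u)^-1 + (z / u)^-1) by rewrite invf_div; ring.
    rewrite E; move: z1 z2; case: (z / u) => x y /= x1 ->.
    rewrite expr1n !div1r.
    have x0 : 0 < x ^+ 2 + 1 by have := sqr_ge0 x; lra.
    have x2 : x ^+ 2 <= 1 by rewrite -real_normK ?num_real// expr_le1.
    have : 2^-1 <= (x ^+ 2 + 1)^-1 by rewrite lef_pV2 ?posrE//; lra.
    by lra.
apply: le_trans (Im_le_cabs _); apply: le_trans (ler_norm _).
rewrite /winding /sq !raddfD /=.
by have := side1 _ u1; have := side1 _ u2; have := side1 _ u3; have := side1 _ u4; lra.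
Qed.

(** The form dz / (z - w) is invariant under the substitution of [w + r%:C * z] for [z], and the
    trapezoidal sums respect this exactly. *)
Lemma sq_inv m w r : 0 < r -> sq m (fun z => (z - w)^-1) w r = winding m.
Proof.
move=> r0; have rC : r%:C != 0 :> R[i] by rewrite -cabs_gt0 cabs_real normr_gt0 gt_eqF.
rewrite /winding /sq /side !seg_scale.
have -> : (fun z => r%:C * (w + r%:C * z - w)^-1) = (fun z => z^-1) :> (R[i] -> R[i]).
  apply/funext => z; rewrite (_ : w + r%:C * z - w = r%:C * z); last by ring.
  by rewrite invfM mulrA divff// mul1r.
congr (_ + _ + _ + _); congr seg; apply/funext => z;
  by rewrite add0r !mul1r.
Qed.

(** Deform to a square of half side [r] around [w]. There [f] differs from [f w] by at most [e / 16]
    and the kernel is at most [1 / r], so the perimeter [8 * r] leaves an error of [e / 2]; the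
    deformation costs the other half. *)
Lemma cauchy_formula f w d : cabs w < d ->
  (forall z, cabs z <= 2 * d -> cdiff f z) ->
  forall e : R, 0 < e ->
  eventually_le (fun m => sq m (fun z => f z * (z - w)^-1) 0 d - f w * winding m) e.
Proof.
move=> wd df e e0; have w0 := cabs_ge0 w.
have e16 : 0 < e / 16 by lra.
have [|r0 r00 cont] := cdiff_continuous (df w _) e16; first by lra.
pose r := Num.min (r0 / 4) (d - cabs w).
have rpos : 0 < r by rewrite lt_min; apply/andP; split; lra.
have r1 : r <= r0 / 4 by rewrite ge_min lexx.
have r2 : r <= d - cabs w by rewrite ge_min lexx orbT.
have e2 : 0 < e / 2 by lra.
have [|||m0 H] := @sq_deform (fun z => f z * (z - w)^-1) w d r _ _ _ _ e2 => //.
- by lra.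
- by move=> z zd zw; apply: cdiffM; [exact: df | exact: cdiffV].
exists m0 => m /H h.
have E : sq m (fun z => f z * (z - w)^-1) 0 d - f w * winding m =
    (sq m (fun z => f z * (z - w)^-1) 0 d - sq m (fun z => f z * (z - w)^-1) w r)
    + sq m (fun z => (f z - f w) * (z - w)^-1) w r.
  have -> : (fun z => (f z - f w) * (z - w)^-1) =
      (fun z => f z * (z - w)^-1 + (- f w) * (z - w)^-1).
    by apply/funext => z; ring.
  by rewrite sqD sqZ sq_inv//; ring.
rewrite E; apply: (le_trans (cabsD _ _)).
have : cabs (sq m (fun z => (f z - f w) * (z - w)^-1) w r) <= 8 * r * (e / 16 / r).
  apply: sq_le => [|z /andP[z1 z2]]; first exact: ltW.
  rewrite cabsM cabsV ler_pM ?cabs_ge0 ?invr_ge0 ?cabs_ge0//.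
    by apply: cont; lra.
  by rewrite lef_pV2 ?posrE//; lra.
have -> : 8 * r * (e / 16 / r) = e / 2 by field; rewrite gt_eqF.
lra.
Qed.

(** Subtract Cauchy's formulas at [w] and 0 on the square of half side 1. The kernels differ by
    [w / ((z - w) * z)], of modulus at most [2 * cabs w]; the perimeter 8 gives [16 * eta * cabs w],
    and [winding_ge] divides by 4. *)
Lemma schwarz_bound f w (eta : R) : cabs w <= 1 / 2 ->
  (forall z, cabs z <= 2 -> cdiff f z) ->
  (forall z, cabs z <= 2 -> cabs (f z) <= eta) ->
  cabs (f w - f 0) <= 4 * eta * cabs w.
Proof.
move=> w2 df feta; apply/ler_addgt0Pr => e e0.
have d1 z : cabs z <= 2 * 1 -> cdiff f z by rewrite mulr1; exact: df.
have w1 : cabs w < 1 by lra.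
have c0 : cabs (0 : R[i]) < 1 by rewrite cabs0.
have [m1 H1] := cauchy_formula w1 d1 e0.
have [m2 H2] := cauchy_formula c0 d1 e0.
pose m := maxn m1 m2.
have h1 := H1 m (leq_maxl _ _); have h2 := H2 m (leq_maxr _ _).
have h3 : cabs (sq m (fun z => f z * (z - w)^-1 + (-1) * (f z * (z - 0)^-1)) 0 1)
    <= 8 * 1 * (2 * eta * cabs w).
  apply: sq_le => // z; rewrite subr0 mulr1 => /andP[z1 z2].
  have zw : 1 / 2 <= cabs (z - w) by have := cabs_dist z w; lra.
  have z0 : z != 0 by rewrite -cabs_gt0; lra.
  have zw0 : z - w != 0 by rewrite -cabs_gt0; lra.
  rewrite (_ : _ + _ = f z * (w / ((z - w) * z))); last by field; rewrite z0 zw0.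
  have e0' : 0 <= eta := le_trans (cabs_ge0 _) (feta _ z2).
  rewrite cabsM (_ : 2 * eta * cabs w = eta * (2 * cabs w)); last by ring.
  rewrite ler_pM ?cabs_ge0 ?feta//.
  have zz : 1 / 2 <= cabs (z - w) * cabs z.
    have : 1 / 2 * 1 <= cabs (z - w) * cabs z by rewrite ler_pM//; lra.
    by lra.
  rewrite cabsM cabsV cabsM mulrC ler_wpM2r ?cabs_ge0//.
  by rewrite -[2]invrK lef_pV2 ?posrE//; lra.
have wg := winding_ge m.
have h4 : cabs ((f w - f 0) * winding m) <= 16 * eta * cabs w + 2 * e.
  have -> : (f w - f 0) * winding m =
    (sq m (fun z => f z * (z - 0)^-1) 0 1 - f 0 * winding m)
    - (sq m (fun z => f z * (z - w)^-1) 0 1 - f w * winding m)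
    + sq m (fun z => f z * (z - w)^-1 + (-1) * (f z * (z - 0)^-1)) 0 1.
    by rewrite sqD sqZ; ring.
  apply: (le_trans (cabsD _ _)); apply: (le_trans (lerD (cabsB _ _) (lexx _))).
  by lra.
have := ler_wpM2l (cabs_ge0 (f w - f 0)) wg; rewrite cabsM in h4.
by lra.
Qed.

(** Raising [N] by one changes the kernel by [z ^- N.+1], which is regular at 1. Its sum against [f]
    can therefore be moved to the square of half side 1/16, inside the disc where [f] is at most
    [delta]; [q] bounds the kernel there and the 1 in [1 + q] pays for the deformation. *)
Lemma small_on_disc_iter N : exists2 B : R, 0 < B & forall f (delta : R), 0 < delta ->
  (forall z, cabs z <= 4 -> cdiff f z) ->
  (forall z, cabs z <= 1 / 8 -> cabs (f z) <= delta) ->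
  eventually_le (fun m => sq m (fun z => f z * (z - 1)^-1) 0 2
    - sq m (fun z => f z * ((z - 1)^-1 * (z - 0) ^- N)) 0 2) (B * delta).
Proof.
elim: N => [|N [B B0 IH]].
  exists 1 => // f delta d0 _ _; exists 0%N => m _.
  have -> : (fun z => f z * ((z - 1)^-1 * (z - 0) ^- 0)) = (fun z => f z * (z - 1)^-1).
    by apply/funext => z; rewrite expr0 invr1 mulr1.
  by rewrite subrr cabs0 mul1r ltW.
pose q : R := (1 / 16) ^- N.+1.
have q0 : 0 < q by rewrite invr_gt0 exprn_gt0.
exists (B + (1 + q)); first by lra.
move=> f delta d0 df fd.
have d1 (z : R[i]) : cabs z <= 2 * 2 -> z != 0 -> cdiff (fun z => f z * (z - 0) ^- N.+1) z.
  move=> z4 z0; apply: cdiffM; last exact: cdiffVn.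
  by apply: df; lra.
have r0 : 0 < 1 / 16 :> R by lra.
have r2 : cabs (0 : R[i]) + 1 / 16 <= 2 by rewrite cabs0; lra.
have h1 := sq_deform r0 r2 d1 d0.
have h2 : eventually_le (fun m => sq m (fun z => f z * (z - 0) ^- N.+1) 0 (1 / 16)) (q * delta).
  exists 0%N => m _; apply: (@le_trans _ _ (8 * (1 / 16) * (delta * q))); last first.
    by have := mulr_gt0 d0 q0; lra.
  apply: sq_le => [|z /andP[]]; first by lra.
  rewrite subr0 => z1 z2; rewrite cabsM cabsV cabsX ler_pM ?invr_ge0 ?exprn_ge0 ?cabs_ge0//.
    by apply: fd; lra.
  by rewrite lef_pV2 ?posrE ?exprn_gt0 ?lerXn2r ?nnegrE//; lra.
have := eventually_leD (IH f delta d0 df fd) (eventually_leD h1 h2).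
have -> : B * delta + (delta + q * delta) = (B + (1 + q)) * delta by ring.
congr (eventually_le _ _); apply/funext => m; rewrite subrK.
rewrite (_ : sq m (fun z => f z * (z - 0) ^- N.+1) 0 2 =
  sq m (fun z => f z * ((z - 1)^-1 * (z - 0) ^- N) +
    (-1) * (f z * ((z - 1)^-1 * (z - 0) ^- N.+1))) 0 2); last first.
  apply: eq_sq => // z; rewrite !subr0 => /andP[z2 _].
  have z0 : z != 0 by rewrite -cabs_gt0; lra.
  have z1 : z - 1 != 0.
    by rewrite -cabs_gt0; have := cabs_dist z 1; rewrite cabs1; lra.
  by rewrite exprS invfM; field; rewrite z0 z1 expf_neq0.
by rewrite sqD sqZ; ring.
Qed.

(* A weak form of Hadamard's three circles theorem. *)
Lemma small_on_disc (M eta : R) : 0 < eta -> exists2 delta : R, 0 < delta & forall f,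
  (forall z, cabs z <= 4 -> cdiff f z) -> (forall z, cabs z <= 4 -> cabs (f z) <= M) ->
  (forall z, cabs z <= 1 / 8 -> cabs (f z) <= delta) -> cabs (f 1) <= eta.
Proof.
(* On the square of half side 2, of perimeter 16, [z ^- N] is at most [2 ^- N] and [(z - 1)^-1] at
   most 1, so the weighted sum is at most [16 * M / 2 ^+ N]. *)
move=> eta0; have [N hN] := geometric_small (16 * M) eta0.
have [B B0 HB] := small_on_disc_iter N.
exists (eta / B); first by rewrite divr_gt0.
move=> f df fM fd.
have delta0 : 0 < eta / B by rewrite divr_gt0.
have c1 : cabs (1 : R[i]) < 2 by rewrite cabs1; lra.
have [m1 H1] := HB f _ delta0 df fd.
have [|m2 H2] := @cauchy_formula f 1 2 c1 _ _ eta0.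
  by move=> z z4; apply: df; lra.
pose m := maxn m1 m2.
have h1 := H1 m (leq_maxl _ _); have h2 := H2 m (leq_maxr _ _).
have BE : B * (eta / B) = eta by field; rewrite gt_eqF.
rewrite BE in h1.
have h3 : cabs (sq m (fun z => f z * ((z - 1)^-1 * (z - 0) ^- N)) 0 2) <= 8 * 2 * (M * (1 * 2 ^- N)).
  apply: sq_le => // z; rewrite !subr0 => /andP[z2 z4].
  have z1 : 1 <= cabs (z - 1) by have := cabs_dist z 1; rewrite cabs1; lra.
  rewrite !cabsM !cabsV cabsX ler_pM ?mulr_ge0 ?invr_ge0 ?exprn_ge0 ?cabs_ge0//.
    by apply: fM; lra.
  rewrite ler_pM ?invr_ge0 ?exprn_ge0 ?cabs_ge0//; first by rewrite invf_le1//; lra.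
  by rewrite lef_pV2 ?posrE ?exprn_gt0 ?lerXn2r ?nnegrE ?cabs_ge0//; lra.
have h4 : cabs (f 1 * winding m) <= 3 * eta.
  have -> : f 1 * winding m =
    - (sq m (fun z => f z * (z - 1)^-1) 0 2 - f 1 * winding m)
    + (sq m (fun z => f z * (z - 1)^-1) 0 2
        - sq m (fun z => f z * ((z - 1)^-1 * (z - 0) ^- N)) 0 2)
    + sq m (fun z => f z * ((z - 1)^-1 * (z - 0) ^- N)) 0 2 by ring.
  apply: (le_trans (cabsD _ _)); apply: (le_trans (lerD (cabsD _ _) (lexx _))).
  rewrite cabsN; move: h3.
  have -> : 8 * 2 * (M * (1 * 2 ^- N)) = 16 * M / 2 ^+ N by ring.
  lra.
have := ler_wpM2l (cabs_ge0 (f 1)) (winding_ge m); rewrite cabsM in h4.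
lra.
Qed.

End Cauchy.

(** * Euclidean norm on C^n *)

Section RowTopology.
Variables (K : numFieldType) (n : nat).

Lemma cvg_row_near (T : Type) (F : set_system T) (FF : Filter F)
    (f : T -> 'rV[K]_n) (l : 'rV[K]_n) : f x @[x --> F] --> l ->
  forall e : K, 0 < e -> \forall x \near F, forall j, `|l 0 j - f x 0 j| < e.
Proof.
move=> /cvg_ballP H e e0; have := H e e0; apply: filterS => x [_ h] j.
by have := h 0 j; rewrite -ball_normE.
Qed.

Lemma nbhs_row (P : set 'rV[K]_n) (z : 'rV[K]_n) (e : K) : 0 < e ->
  (forall w : 'rV[K]_n, (forall j, `|z 0 j - w 0 j| < e) -> P w) -> nbhs z P.
Proof.
move=> e0 H; apply/nbhs_ballP; exists e => //= w [_ h]; apply: H => j.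
by have := h 0 j; rewrite -ball_normE.
Qed.

Lemma differentiable_line (f : 'rV[K]_n -> 'rV[K]_n) (p v : 'rV[K]_n) (z : K) j :
  differentiable f (p + z *: v) -> exists l : K, forall e : K, 0 < e ->
  exists2 d : K, 0 < d & forall w, `|w - z| < d ->
    `|f (p + w *: v) 0 j - f (p + z *: v) 0 j - l * (w - z)| <= e * `|w - z|.
Proof.
move=> /(@diff_derivable _ _ _ _ _ v) /cvg_ex[/= l H]; exists (l 0 j) => e e0.
have := cvg_row_near (dnbhs_filter _) H e0; rewrite near_withinE => /nbhs_ballP[d /= d0 Hd].
exists d => // w; have [->|wz] := eqVneq w z.
  by rewrite !subrr mulr0 subrr normr0 mulr0.
move=> wd; have h0 : w - z != 0 by rewrite subr_eq0.
have := Hd (w - z); rewrite -ball_normE /= sub0r normrN => /(_ wd h0 j).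
have -> : (w - z) *: v + (p + z *: v) = p + w *: v.
  by rewrite addrCA -scalerDl subrK.
rewrite !mxE; set u := f (p + w *: v) 0 j; set u0 := f (p + z *: v) 0 j.
have -> : u - u0 - l 0 j * (w - z) = ((w - z)^-1 * (u - u0) - l 0 j) * (w - z) by field.
by rewrite normrM distrC => /ltW h; rewrite ler_wpM2r.
Qed.

End RowTopology.

Section EuclideanNorm.
Variables (R : realType) (n : nat).
Implicit Types (z w p v : 'rV[R[i]]_n).

Lemma enorm_ge0 z : 0 <= enorm z. Proof. exact: sqrtr_ge0. Qed.

Let sumsq z := \sum_(k < n) cabs (z 0 k) ^+ 2.

Let sumsq_ge0 z : 0 <= sumsq z.
Proof. by apply: sumr_ge0 => k _; exact: sqr_ge0. Qed.

Let enormE z : enorm z ^+ 2 = sumsq z.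
Proof. exact: (sqr_sqrtr (sumsq_ge0 z)). Qed.

Lemma cabs_le_enorm z k : cabs (z 0 k) <= enorm z.
Proof.
rewrite -(@ler_pXn2r _ 2) ?nnegrE ?cabs_ge0 ?enorm_ge0// enormE /sumsq (bigD1 k)//=.
by rewrite lerDl sumr_ge0// => j _; exact: sqr_ge0.
Qed.

Lemma enorm_le (z : 'rV[R[i]]_n) (c : R) : 0 <= c ->
  (forall k, cabs (z 0 k) <= c) -> enorm z <= n%:R * c.
Proof.
move=> c0 H; have nc : 0 <= n%:R * c by rewrite mulr_ge0.
rewrite -(@ler_pXn2r _ 2) ?nnegrE ?enorm_ge0// enormE.
apply: (@le_trans _ _ (\sum_(k < n) c ^+ 2)).
  by apply: ler_sum => k _; rewrite lerXn2r ?nnegrE ?cabs_ge0.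
rewrite sumr_const card_ord -[leLHS]mulr_natl exprMn ler_wpM2r ?sqr_ge0// -natrX ler_nat.
by case: (n) => // m; rewrite expnS leq_pmulr.
Qed.

Lemma enormZ (c : R[i]) z : enorm (c *: z) = cabs c * enorm z.
Proof.
apply/eqP; rewrite -(@eqrXn2 _ 2) ?mulr_ge0 ?enorm_ge0 ?cabs_ge0//.
rewrite exprMn !enormE /sumsq mulr_sumr; apply/eqP; apply: eq_bigr => k _.
by rewrite mxE cabsM exprMn.
Qed.

Lemma enorm0 : enorm (0 : 'rV[R[i]]_n) = 0.
Proof. by rewrite -(scale0r 0) enormZ cabs0 mul0r. Qed.

Lemma enormN z : enorm (- z) = enorm z.
Proof. by rewrite -scaleN1r enormZ cabsN cabs1 mul1r. Qed.

Lemma enormBC z w : enorm (z - w) = enorm (w - z).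
Proof. by rewrite -enormN opprB. Qed.

(** With [a] and [b] slightly above the two norms, hence positive, the inequality [(x + y) ^+ 2 <=
    (1 + b / a) * x ^+ 2 + (1 + a / b) * y ^+ 2] is summed over the coordinates. *)
Lemma enormD z w : enorm (z + w) <= enorm z + enorm w.
Proof.
apply/ler_addgt0Pr => e e0.
pose a := enorm z + e / 2; pose b := enorm w + e / 2.
have a0 : 0 < a by rewrite /a; have := enorm_ge0 z; lra.
have b0 : 0 < b by rewrite /b; have := enorm_ge0 w; lra.
suff : enorm (z + w) <= a + b by rewrite /a /b; lra.
rewrite -(@ler_pXn2r _ 2) ?nnegrE ?enorm_ge0//; last by lra.
have za : sumsq z <= a ^+ 2.
  by rewrite -enormE lerXn2r ?nnegrE ?enorm_ge0 ?(ltW a0)// /a; lra.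
have wb : sumsq w <= b ^+ 2.
  by rewrite -enormE lerXn2r ?nnegrE ?enorm_ge0 ?(ltW b0)// /b; lra.
have ba : 0 <= b / a by rewrite divr_ge0 // ltW.
have ab : 0 <= a / b by rewrite divr_ge0 // ltW.
have abn : (a != 0) * (b != 0) by rewrite !gt_eqF.
rewrite enormE; apply: (@le_trans _ _ ((1 + b / a) * sumsq z + (1 + a / b) * sumsq w)).
  rewrite /sumsq !mulr_sumr -big_split; apply: ler_sum => k _ /=; rewrite mxE.
  set x := cabs (z 0 k); set y := cabs (w 0 k).
  apply: (@le_trans _ _ ((x + y) ^+ 2)).
    by rewrite lerXn2r ?nnegrE ?addr_ge0 ?cabs_ge0 ?cabsD.
  rewrite -subr_ge0.
  have -> : (1 + b / a) * x ^+ 2 + (1 + a / b) * y ^+ 2 - (x + y) ^+ 2 =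
    (b * x - a * y) ^+ 2 / (a * b) by field; rewrite !abn.
  by rewrite divr_ge0 ?sqr_ge0 ?mulr_ge0 ?(ltW a0) ?(ltW b0).
have -> : (a + b) ^+ 2 = (1 + b / a) * a ^+ 2 + (1 + a / b) * b ^+ 2.
  by field; rewrite !abn.
by rewrite lerD// ler_wpM2l//; lra.
Qed.

Lemma enormB z w : enorm (z - w) <= enorm z + enorm w.
Proof. by rewrite -(enormN w) enormD. Qed.

Lemma enorm_triangle w z v : enorm (z - v) <= enorm (z - w) + enorm (w - v).
Proof. by rewrite -[z - v](subrKA w) enormD. Qed.

Lemma normcE_cabs (c : R[i]) : `|c| = (cabs c)%:C.
Proof. by rewrite normc_def; case: c. Qed.

Lemma ltC_cabs (c : R[i]) (e : R) : (`|c| < e%:C) = (cabs c < e).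
Proof. by rewrite normcE_cabs ltcR. Qed.

Lemma open_eball p (r : R) : open (eball p r).
Proof.
rewrite openE => z /= zr; rewrite /interior.
pose d := (r - enorm (z - p)) / n.+1%:R.
have d0 : 0 < d by rewrite divr_gt0// subr_gt0.
apply: (@nbhs_row _ _ _ _ d%:C); first by rewrite ltcR.
move=> w H; rewrite /eball /=.
have : enorm (w - z) <= n%:R * d.
  apply: enorm_le => [|k]; first exact: ltW.
  by rewrite !mxE cabsBC; apply/ltW; rewrite -ltC_cabs.
have : n%:R * d + d = r - enorm (z - p).
  by rewrite -[X in _ + X]mul1r -mulrDl natr1 /d mulrC divfK.
have := enorm_triangle z w p; lra.
Qed.

(** Hands the coordinates of a holomorphic map along a complex line to the one-variable theory. A
    positive element of [R[i]] is real, so [d] equals its real part. *)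
Lemma cdiff_line (f : 'rV[R[i]]_n -> 'rV[R[i]]_n) p v (z : R[i]) j :
  differentiable f (p + z *: v) -> cdiff (fun c => f (p + c *: v) 0 j) z.
Proof.
move=> /(@differentiable_line _ _ f p v z j)[l H]; exists l => e e0.
have [|d d0 Hd] := H e%:C; first by rewrite ltcR.
have dE : d = (complex.Re d)%:C by rewrite RRe_real// ger0_real// ltW.
exists (complex.Re d); first by rewrite -ltcR -dE.
move=> w wd; have := Hd w; rewrite dE ltC_cabs => /(_ wd).
by rewrite !normcE_cabs -rmorphM lecR.
Qed.

Lemma generates_near D g (X : 'rV[R[i]]_n -> 'rV[R[i]]_n) z :
  generates D g X -> D z -> g 0 z = z -> forall e : R, 0 < e ->
  exists2 d : R, 0 < d & forall t, `|t| < d ->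
    enorm (g t z - z - t%:C *: X z) <= e * `|t|.
Proof.
move=> gX Dz g0 e e0.
have n0 : 0 < n.+1%:R :> R by [].
(* Dividing by [n.+1], which is never 0, absorbs the factor [n] of [enorm_le]. *)
have e1 : 0 < (e / n.+1%:R)%:C :> R[i] by rewrite ltcR divr_gt0.
have := cvg_row_near (dnbhs_filter _) (gX z Dz) e1; rewrite near_withinE => /nbhs_ballP[d /= d0 Hd].
exists d => // t td; have [->|t0] := eqVneq t 0.
  by rewrite g0 subrr sub0r enormN scale0r enorm0 normr0 mulr0.
have := Hd t; rewrite -ball_normE /= sub0r normrN g0 => /(_ td t0) H.
have tC : t%:C != 0 :> R[i] by rewrite -cabs_gt0 cabs_real normr_gt0.
have -> : g t z - z - t%:C *: X z = t%:C *: ((t^-1)%:C *: (g t z - z) - X z).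
  by rewrite scalerBr scalerA -rmorphM divff// scale1r.
rewrite enormZ cabs_real mulrC ler_wpM2r//.
apply: (@le_trans _ _ (n%:R * (e / n.+1%:R))).
  apply: enorm_le => [|k]; first by rewrite ltW// divr_gt0.
  by apply/ltW; rewrite -ltC_cabs; have := H k; rewrite !mxE distrC.
rewrite mulrA ler_pdivrMr// mulrC ler_wpM2l// ?ler_nat//; exact: ltW.
Qed.

End EuclideanNorm.

(** * Flows of holomorphic maps *)

Section Flow.
Variables (R : realType) (n : nat).
Implicit Types (D : set 'rV[R[i]]_n) (z p : 'rV[R[i]]_n)
  (X : 'rV[R[i]]_n -> 'rV[R[i]]_n) (g : R -> 'rV[R[i]]_n -> 'rV[R[i]]_n).

(** Consider the supremum of the times up to which [P] holds: [left_closed] includes it, and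
    [right_open] moves past it unless it is [T]. At [t = 0] the premise of [left_closed] is vacuous,
    which starts the induction. *)
Lemma real_induction (T : R) (P : R -> Prop) :
  (forall t : R, 0 <= t < T -> (forall u : R, 0 <= u <= t -> P u) ->
    exists2 d : R, 0 < d & forall h : R, 0 < h < d -> P (t + h)) ->
  (forall t : R, 0 <= t <= T -> (forall u : R, 0 <= u < t -> P u) -> P t) ->
  forall t : R, 0 <= t <= T -> P t.
Proof.
move=> right_open left_closed t /andP[t0 tT].
pose S := [set u : R | 0 <= u <= T /\ forall v : R, 0 <= v <= u -> P v].
have T0 : 0 <= T by lra.
have S0 : S 0.
  split=> [|v v0]; first by rewrite lexx.
  have -> : v = 0 by lra.
  by apply: left_closed => [|u]; [rewrite lexx | lra].
have Sub : has_ubound S by exists T => u [/andP[]].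
have Ssup : has_sup S by split => //; exists 0.
set m := sup S.
have m0 : 0 <= m by apply: ub_le_sup.
have mT : m <= T by apply: ge_sup; [exists 0 | move=> u [/andP[]]].
have Pm u : 0 <= u < m -> P u.
  move=> /andP[u0 um]; have um' : 0 < m - u by lra.
  have [x [_ Sx] ux] := sup_adherent um' Ssup; apply: Sx.
  by rewrite u0 /=; move: ux; rewrite -/m; lra.
have Pm' u : 0 <= u <= m -> P u.
  move=> /andP[u0]; rewrite le_eqVlt => /orP[/eqP ->|um]; last by apply: Pm; rewrite u0.
  by apply: left_closed => //; rewrite m0.
have [mT'|Tm] := ltP m T; last by apply: Pm'; rewrite t0; lra.
have [|d d0 Hd] := right_open m _ Pm'; first by rewrite m0.
pose h := Num.min (d / 2) (T - m).
have h0 : 0 < h by rewrite lt_min; apply/andP; split; lra.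
have hd : h <= d / 2 by rewrite ge_min lexx.
have hT : h <= T - m by rewrite ge_min lexx orbT.
have : S (m + h).
  split=> [|v /andP[v0 vmh]]; first by apply/andP; split; lra.
  have [vm|mv] := leP v m; first by apply: Pm'; rewrite v0.
  have -> : v = m + (v - m) by ring.
  by apply: Hd; lra.
by move=> /(ub_le_sup Sub); rewrite -/m; lra.
Qed.

(* What is used of a generated one-parameter group on a set inside the ball of
   radius [Rad]. *)
Definition flow_on (Rad : R) D g X : Prop :=
  [/\ forall t z, D z -> D (g t z),
      forall z, D z -> g 0 z = z,
      forall t u z, D z -> g (t + u) z = g u (g t z),
      forall z, D z -> forall e : R, 0 < e -> exists2 d : R, 0 < d &
        forall t, `|t| < d -> enorm (g t z - z - t%:C *: X z) <= e * `|t| &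
      (forall t p (v : 'rV[R[i]]_n) (c : R[i]) j, D (p + c *: v) ->
        cdiff (fun c => g t (p + c *: v) 0 j) c) /\
      (forall z, D z -> enorm z <= Rad)].

Lemma flow_displacement_near Rad D g X z : flow_on Rad D g X -> D z ->
  forall e : R, 0 < e -> exists2 d : R, 0 < d & forall t, `|t| < d ->
    enorm (g t z - z) <= (enorm (X z) + e) * `|t|.
Proof.
move=> [_ _ _ gX _] Dz e e0; have [d d0 Hd] := gX z Dz e e0.
exists d => // t /Hd h; have := enormD (g t z - z - t%:C *: X z) (t%:C *: X z).
by rewrite subrK enormZ cabs_real; lra.
Qed.

(** While the displacement is at most [2 * A * t <= rho / 2], the orbit stays in the ball where the
    speed is at most [A]; the factor 2 leaves room for the first-order error. *)
Lemma flow_displacement Rad D g X p (rho A : R) : flow_on Rad D g X ->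
  eball p rho `<=` D -> 0 < A -> (forall z, eball p rho z -> enorm (X z) <= A) ->
  forall z T, eball p (rho / 2) z -> A * T <= rho / 4 ->
  forall t, 0 <= t <= T -> enorm (g t z - z) <= 2 * A * t.
Proof.
move=> fl BD A0 XA z T; rewrite /eball /= => zp AT.
have [gD g0 gadd _ _] := fl.
have rho0 : 0 < rho by have := enorm_ge0 (z - p); lra.
have Dz : D z by apply: BD; rewrite /eball /=; lra.
apply: (@real_induction T (fun t => enorm (g t z - z) <= 2 * A * t)).
  move=> t /andP[t0 tT] H.
  have yz : enorm (g t z - z) <= 2 * A * t by apply: H; rewrite t0 lexx.
  have tT' : A * t <= A * T by rewrite ler_pM2l// ltW.
  have yB : eball p rho (g t z).
    by rewrite /eball /=; have := enorm_triangle z (g t z) p; lra.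
  have [d d0 Hd] := flow_displacement_near fl (gD t z Dz) A0.
  exists d => // h /andP[h0 hd].
  have := Hd h; rewrite gtr0_norm// => /(_ hd) dh.
  have : (enorm (X (g t z)) + A) * h <= 2 * A * h.
    by rewrite ler_pM2r//; have := XA _ yB; lra.
  rewrite gadd//; have := enorm_triangle (g t z) (g h (g t z)) z; lra.
(* Left continuity comes from the group law: [g (t - h) z] is [g (- h) y] with [y = g t z], and the
   expansion at [y] bounds its distance to [y] by [B * h <= e]. *)
move=> t /andP[t0 tT] H.
have := t0; rewrite le_eqVlt => /orP[/eqP <-|tpos].
  by rewrite g0// subrr enorm0 mulr0.
apply/ler_addgt0Pr => e e0.
have [d d0 Hd] := flow_displacement_near fl (gD t z Dz) ltr01.
set y := g t z in Hd *.
pose B := enorm (X y) + 1.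
have B0 : 0 < B by rewrite /B; have := enorm_ge0 (X y); lra.
pose h := Num.min (d / 2) (Num.min t (e / B)).
have h0 : 0 < h by rewrite !lt_min tpos !divr_gt0.
have hd : h <= d / 2 by rewrite ge_min lexx.
have ht : h <= t by rewrite !ge_min lexx orbT.
have he : h <= e / B by rewrite !ge_min lexx !orbT.
have hB : B * h <= e by rewrite mulrC -ler_pdivlMr.
have := Hd (- h); rewrite normrN gtr0_norm// => h1.
have {}h1 : enorm (g (- h) y - y) <= B * h by apply: h1; lra.
have h2 : enorm (g (- h) y - z) <= 2 * A * (t - h).
  by rewrite /y -gadd//; apply: H; lra.
have Ah : 0 <= A * h by rewrite mulr_ge0// ltW.
have := enorm_triangle (g (- h) y) y z; rewrite (enormBC y (g _ _)); lra.
Qed.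

Lemma cdiff_displacement Rad D g X t p (v : 'rV[R[i]]_n) (c : R[i]) j :
  flow_on Rad D g X -> D (p + c *: v) ->
  cdiff (fun c => g t (p + c *: v) 0 j + (-1) * (p + c *: v) 0 j) c.
Proof.
move=> [_ _ _ _ [gdiff _]] Dc; apply: cdiffD; first exact: gdiff.
have -> : (fun c : R[i] => (-1) * (p + c *: v) 0 j) =
    (fun c => - p 0 j + c * (- v 0 j)).
  by apply/funext => x; rewrite !mxE; ring.
exact: cdiff_affine.
Qed.

(** Apply [small_on_disc] on the complex line with [p] at parameter 0 and [z] at 1: parameters up to
    4 stay in the ball of radius [16 * rho], where the displacement is at most [2 * Rad], and those
    up to 1/8 in the ball of radius [rho / 2], where [flow_displacement] applies. *)
Lemma flow_small Rad (rho eta : R) : 0 < rho -> 0 < eta ->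
  exists2 delta : R, 0 < delta & forall p D g X A, flow_on Rad D g X ->
  eball p (16 * rho) `<=` D -> 0 < A ->
  (forall z, eball p rho z -> enorm (X z) <= A) ->
  forall z t j, eball p (4 * rho) z -> 0 <= t <= delta / A ->
  cabs (g t z 0 j - z 0 j) <= eta.
Proof.
move=> rho0 eta0; have [d0 d00 H] := small_on_disc (2 * Rad) eta0.
(* [d0 / 2] gives [2 * A * t <= d0]; [rho / 4] is the time limit in [flow_displacement]. *)
pose delta := Num.min (d0 / 2) (rho / 4).
have dpos : 0 < delta by rewrite lt_min; apply/andP; split; lra.
have dd : delta <= d0 / 2 by rewrite ge_min lexx.
have drho : delta <= rho / 4 by rewrite ge_min lexx orbT.
exists delta => // p D g X A fl BD A0 XA z t j zp /andP[t0 tT].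
have [gD _ _ _ [_ DRad]] := fl.
have At : A * t <= delta by rewrite mulrC -ler_pdivlMr.
have ball_line (c : R[i]) (r : R) : cabs c <= r -> 0 < r ->
    eball p (r * (4 * rho)) (p + c *: (z - p)).
  move=> cr r0; rewrite /eball /= addrC addKr enormZ.
  apply: (@le_lt_trans _ _ (r * enorm (z - p))); first by rewrite ler_wpM2r ?enorm_ge0.
  by rewrite ltr_pM2l.
have line_D (c : R[i]) : cabs c <= 4 -> D (p + c *: (z - p)).
  move=> c4; apply: BD; have -> : 16 * rho = 4 * (4 * rho) by ring.
  exact: ball_line.
have := H (fun c => g t (p + c *: (z - p)) 0 j + (-1) * (p + c *: (z - p)) 0 j).
have -> : p + 1 *: (z - p) = z by rewrite scale1r addrC subrK.
rewrite mulN1r; apply.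
- by move=> c /line_D Dc; exact: (cdiff_displacement t j fl Dc).
- move=> c /line_D Dc; rewrite mulN1r; apply: (le_trans (cabsB _ _)).
  have := cabs_le_enorm (g t (p + c *: (z - p))) j; have := DRad _ (gD t _ Dc).
  by have := cabs_le_enorm (p + c *: (z - p)) j; have := DRad _ Dc; lra.
- move=> c c8; have Bc : eball p (rho / 2) (p + c *: (z - p)).
    have -> : rho / 2 = 1 / 8 * (4 * rho) by field.
    by apply: ball_line => //; lra.
  have BD' : eball p rho `<=` D.
    by move=> y yp; apply: BD; move: yp; rewrite /eball /=; lra.
  have := flow_displacement fl BD' A0 XA Bc (T := t) _ (t := t).
  have := cabs_le_enorm (g t (p + c *: (z - p)) - (p + c *: (z - p))) j.
  rewrite !mxE mulN1r; have : A * t <= rho / 4 by lra.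
  have tt : 0 <= t <= t by rewrite t0 lexx.
  by move=> h1 h2 /(_ h1 tt); lra.
Qed.

Lemma field_propagation Rad (rho : R) : 0 < rho -> exists2 C : R, 0 < C &
  forall p D g X A, flow_on Rad D g X -> eball p (16 * rho) `<=` D -> 0 < A ->
  (forall z, eball p rho z -> enorm (X z) <= A) ->
  forall z, eball p (2 * rho) z -> enorm (X z) <= C * A.
Proof.
move=> rho0; have n0 : 0 < n.+1%:R :> R by [].
(* Makes the Lipschitz constant [n%:R * (4 * eta / rho)] in [contract] at most 1/2. *)
pose eta := rho / (8 * n.+1%:R).
have eta0 : 0 < eta by rewrite divr_gt0// mulr_gt0.
have [delta delta0 small] := flow_small Rad rho0 eta0.
(* Twice the displacement [n%:R * eta] at time [T], divided by [T = delta / A]; the 1 keeps the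
   constant positive for every [n]. *)
exists (2 * (n%:R * eta) / delta + 1).
  by rewrite ltr_wpDl// divr_ge0 ?mulr_ge0 // ltW.
move=> p D g X A fl BD A0 XA z zp.
have [gD g0 gadd gX [_ _]] := fl.
have D4 y : eball p (4 * rho) y -> D y.
  by move=> yp; apply: BD; move: yp; rewrite /eball /=; lra.
have z4 : eball p (4 * rho) z by move: zp; rewrite /eball /=; lra.
have Dz := D4 z z4.
pose T := delta / A.
have T0 : 0 < T by rewrite divr_gt0.
(* [schwarz_bound] is used on the line from [z] through [z'], with direction [v] rescaled to norm
   [rho]. Then [z'] has parameter [enorm (z' - z) / rho <= 1 / 2], and parameters up to 2 stay
   within [4 * rho] of [p]. *)
have contract t z' : 0 <= t <= T -> enorm (z' - z) <= rho / 2 ->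
    enorm ((g t z' - z') - (g t z - z)) <= enorm (z' - z) / 2.
  move=> tT zz'; have [->|zneq] := eqVneq z' z; first by rewrite !subrr enorm0 mul0r.
  have e0 : 0 < enorm (z' - z).
    rewrite lt_neqAle enorm_ge0 andbT eq_sym; apply: contra zneq => /eqP h.
    rewrite -subr_eq0; apply/eqP/rowP => k; rewrite [RHS]mxE.
    by apply: Normc.eq0_normc; apply/le_anti; rewrite cabs_ge0 -[X in _ <= X]h cabs_le_enorm.
  pose k := rho / enorm (z' - z).
  have k0 : 0 < k by rewrite divr_gt0.
  pose w := k^-1.
  pose v := k%:C *: (z' - z).
  have line4 (c : R[i]) : cabs c <= 2 -> eball p (4 * rho) (z + c *: v).
    move=> c2; rewrite /eball /=.
    have : enorm (c *: v) <= 2 * rho.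
      rewrite !enormZ cabs_real gtr0_norm// /k divfK ?gt_eqF//.
      by rewrite ler_pM2r.
    have := enormD (z - p) (c *: v); rewrite addrAC.
    by move: zp; rewrite /eball /=; lra.
  have comp j : cabs (((g t z' - z') - (g t z - z)) 0 j) <= 4 * eta * (enorm (z' - z) / rho).
    have := @schwarz_bound R (fun c => g t (z + c *: v) 0 j + (-1) * (z + c *: v) 0 j) w%:C eta.
    have cw : cabs w%:C = enorm (z' - z) / rho.
      by rewrite cabs_real gtr0_norm ?invr_gt0// /w /k invf_div.
    have zv : z + w%:C *: v = z'.
      by rewrite /v /w scalerA -rmorphM mulVf ?gt_eqF// scale1r addrC subrK.
    rewrite cw scale0r addr0 zv.
    rewrite !mulN1r !mxE; apply.
    - by rewrite ler_pdivrMr//; lra.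
    - by move=> c /line4/D4 Dc; exact: (cdiff_displacement t j fl Dc).
    - by move=> c /line4 Dc; rewrite mulN1r; exact: (small p D g X A).
  apply: (@le_trans _ _ (n%:R * (4 * eta * (enorm (z' - z) / rho)))).
    by apply: enorm_le => //; rewrite !mulr_ge0 ?enorm_ge0 ?invr_ge0// ltW.
  have -> : n%:R * (4 * eta * (enorm (z' - z) / rho)) =
    n%:R / n.+1%:R * (enorm (z' - z) / 2).
    by rewrite /eta; field; rewrite !gt_eqF.
  rewrite ler_piMl ?divr_ge0 ?enorm_ge0// ler_pdivrMr// mul1r ler_nat.
  exact: leqnSn.
apply/ler_addgt0Pr => e e0.
have [d1 d10 H1] := gX z Dz _ e0.
have [d2 d20 H2] := flow_displacement_near fl Dz ltr01.
pose B := enorm (X z) + 1.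
have B0 : 0 < B by rewrite /B; have := enorm_ge0 (X z); lra.
(* [d1] is for the expansion of [g tau z] at [z]; the other two bounds bring [z'] within [rho / 2]
   of [z], as [contract] demands. *)
pose h := Num.min d1 (Num.min d2 (rho / 2 / B)).
have h0 : 0 < h by rewrite !lt_min d10 d20 !divr_gt0.
have [N [N0 hN]] : exists N, 0 < N%:R :> R /\ T / N%:R < h.
  exists (Num.Def.archi_bound (T / h)).+1; split => //.
  rewrite ltr_pdivrMr// mulrC -ltr_pdivrMr//.
  have Th : 0 <= T / h by rewrite divr_ge0 // ltW.
  by apply: (lt_trans (archi_boundP Th)); rewrite ltr_nat.
pose tau := T / N%:R.
have tau0 : 0 < tau by rewrite divr_gt0.
move: hN; rewrite -/tau !lt_min => /and3P[ta1 ta2 ta3].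
pose z' := g tau z.
have z'1 : enorm (z' - z - tau%:C *: X z) <= e * tau.
  by have := H1 tau; rewrite gtr0_norm// => /(_ ta1).
have z'2 : enorm (z' - z) <= rho / 2.
  have := H2 tau; rewrite gtr0_norm// => /(_ ta2) h2.
  apply: (le_trans h2); rewrite -/B mulrC -ler_pdivlMr//; exact: ltW.
have telescope k : (k <= N)%N ->
    enorm (g (k%:R * tau) z - z - k%:R *: (z' - z)) <= k%:R * (enorm (z' - z) / 2).
  elim: k => [|k IH] kN.
    by rewrite !mul0r scale0r g0// !subrr enorm0.
  have -> : k.+1%:R * tau = tau + k%:R * tau by rewrite -natr1; ring.
  rewrite gadd// -/z'.
  have -> : g (k%:R * tau) z' - z - k.+1%:R *: (z' - z) =
    ((g (k%:R * tau) z' - z') - (g (k%:R * tau) z - z))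
    + (g (k%:R * tau) z - z - k%:R *: (z' - z)).
    rewrite -natr1 scalerDl scale1r.
    by apply/rowP => j; rewrite !mxE; ring.
  apply: (le_trans (enormD _ _)).
  have -> : k.+1%:R * (enorm (z' - z) / 2) =
    enorm (z' - z) / 2 + k%:R * (enorm (z' - z) / 2) by rewrite -natr1; ring.
  apply: lerD; last by apply: IH; exact: ltnW.
  apply: contract => //; rewrite mulr_ge0 ?(ltW tau0)//=.
  have -> : T = N%:R * tau by rewrite /tau mulrC divfK// gt_eqF.
  by rewrite ler_pM2r// ler_nat ltnW.
have NT : N%:R * tau = T by rewrite /tau mulrC divfK// gt_eqF.
have := telescope N (leqnn N); rewrite NT => tel.
have gTz : enorm (g T z - z) <= n%:R * eta.
  apply: enorm_le => [|j]; first exact: ltW.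
  rewrite !mxE; apply: (small p D g X A) => //.
  by rewrite lexx (ltW T0).
(* By the triangle inequality, half of [N%:R * enorm (z' - z)] survives the error allowed by
   [tel]. *)
have Nz : N%:R * enorm (z' - z) <= 2 * (n%:R * eta).
  have : enorm (N%:R *: (z' - z)) = N%:R * enorm (z' - z) by rewrite enormZ cabs_nat.
  have := enorm_triangle (g T z - z) (N%:R *: (z' - z)) 0.
  rewrite !subr0 (enormBC (N%:R *: _)).
  lra.
have Xtau : tau * enorm (X z) <= enorm (z' - z) + e * tau.
  have := enormB (z' - z) (z' - z - tau%:C *: X z).
  by rewrite subKr enormZ cabs_real gtr0_norm//; lra.
have : N%:R * (tau * enorm (X z)) <= N%:R * (enorm (z' - z) + e * tau).
  by rewrite ler_pM2l.
have -> : N%:R * (tau * enorm (X z)) = T * enorm (X z) by rewrite mulrA NT.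
have -> : N%:R * (enorm (z' - z) + e * tau) = N%:R * enorm (z' - z) + T * e.
  by rewrite -NT; ring.
move=> fin.
have {}fin : T * enorm (X z) <= T * (2 * (n%:R * eta) / T + e).
  have -> : T * (2 * (n%:R * eta) / T + e) = 2 * (n%:R * eta) + T * e.
    by field; rewrite gt_eqF.
  lra.
move: fin; rewrite ler_pM2l//.
have -> : 2 * (n%:R * eta) / T = 2 * (n%:R * eta) / delta * A.
  by rewrite /T; field; rewrite !gt_eqF.
rewrite mulrDl mul1r; lra.
Qed.

End Flow.

(** * Chaining over a connected compact set *)

Section Chaining.
Variables (R : realType) (n : nat).

(** The points that have some constant form a nonempty subset of [K], relatively open by [step] and
    relatively closed because [step] also runs backwards; by connectedness it is [K]. The constants
    may vary with the point, so a finite cover by balls makes [c] uniform at the cost of passing to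
    a nearby centre [q']. *)
Lemma compact_connected_induction (K : set 'rV[R[i]]_n) (rho : R)
    (good : 'rV[R[i]]_n -> R -> Prop) : connected K -> compact K -> K 0 -> 0 < rho ->
  (forall q c c', good q c -> c <= c' -> good q c') ->
  (exists c, good 0 c) ->
  (forall q q' c, K q -> enorm (q' - q) < rho -> good q c -> exists c', good q' c') ->
  exists2 c, 0 < c & forall q, K q -> exists2 q', good q' c & enorm (q - q') < rho.
Proof.
move=> Kconn Kcomp K0 rho0 mono good0 step.
have self q : eball q rho q by rewrite /eball /= subrr enorm0.
pose U := [set q | K q /\ exists c, good q c].
have UK : U = K.
  apply: Kconn.
  - by exists 0.
  - exists (\bigcup_(q in U) eball q rho); first by apply: bigcup_open => q _; exact: open_eball.
    apply/seteqP; split=> [q Uq|q' [Kq' [q [Kq [c gq]] qq']]].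
      by split; [case: Uq | exists q].
    by split => //; exact: (step q q' c).
  - exists (~` \bigcup_(q in K `\` U) eball q rho).
      by apply: open_closedC; apply: bigcup_open => q _; exact: open_eball.
    apply/seteqP; split=> [q' [Kq' [c gq']]|q [Kq nq]].
      split => // -[q [Kq nUq] qq']; apply: nUq; split => //.
      by apply: (step q' q c) => //; rewrite enormBC.
    by apply: contrapT => nUq; apply: nq; exists q.
have [l lK Kl] : exists2 l : seq 'rV[R[i]]_n, (forall q, q \in l -> K q) &
    forall q, K q -> exists2 q', q' \in l & eball q' rho q.
  move: Kcomp; rewrite compact_cover => /(_ _ K (fun q => eball q rho)) [].
  - by move=> q _; exact: open_eball.
  - by move=> q Kq; exists q.
  - move=> L LK KL; exists (finmap.enum_fset L) => [q /LK|q /KL[q' /= Lq' qq']].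
      by rewrite inE.
    by exists q'.
suff [c c0 Hc] : exists2 c, 0 < c & forall q, q \in l -> good q c.
  by exists c => // q /Kl[q' /Hc gq' qq']; exists q'.
elim: l lK {Kl} => [|q l IH] lK; first by exists 1.
have [|c c0 Hc] := IH; first by move=> q' ql; apply: lK; rewrite inE ql orbT.
have [Kq [c' gq]] : U q by rewrite UK; apply: lK; rewrite inE eqxx.
exists (Num.max c c'); first by rewrite lt_max c0.
move=> q'; rewrite inE => /orP[/eqP ->|/Hc g'].
  by apply: mono gq _; rewrite le_max lexx orbT.
by apply: mono g' _; rewrite le_max lexx.
Qed.

Lemma flow_on_action (Rad : R) (D : set 'rV[R[i]]_n) g X : D `<=` eball 0 Rad ->
  one_parameter_action D g -> generates D g X -> flow_on Rad D g X.
Proof.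
move=> DRad [gaut g0 gadd _] gX; split => //.
- by move=> t z Dz; have [_ gD _] := gaut t; exact: gD.
- by move=> z Dz e e0; exact: (generates_near gX Dz (g0 z Dz)).
split=> [t p v c j Dc|z /DRad]; last by rewrite /eball /= subr0 => /ltW.
by have [hol _ _] := gaut t; apply: cdiff_line; exact: hol.
Qed.

(** An infinite supremum over [F] is trivial. A finite one may be 0 while the assumption asks for
    [A > 0], so it is applied to [a + e / C]. *)
Lemma supnorm_le (E F : set 'rV[R[i]]_n) X (C : R) : 0 < C -> F !=set0 ->
  (forall A : R, 0 < A -> (forall z, F z -> enorm (X z) <= A) ->
    forall z, E z -> enorm (X z) <= C * A) ->
  (supnorm E X <= C%:E * supnorm F X)%E.
Proof.
move=> C0 [z0 Fz0] H.
have ub z : F z -> ((enorm (X z))%:E <= supnorm F X)%E.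
  by move=> Fz; apply: ereal_sup_ubound; exists z.
case: (supnorm F X) ub => [a||] ub.
- apply: ge_ereal_sup => _ [z Ez <-]; rewrite -EFinM lee_fin.
  have a0 : 0 <= a by have := ub _ Fz0; rewrite lee_fin; apply: le_trans; exact: enorm_ge0.
  apply/ler_addgt0Pr => e e0.
  have -> : C * a + e = C * (a + e / C) by field; rewrite gt_eqF.
  have eC : 0 < e / C by rewrite divr_gt0.
  apply: H Ez; first by lra.
  by move=> w /ub; rewrite lee_fin => /le_trans; apply; lra.
- by rewrite gt0_muley ?lte_fin// leey.
- by have := ub _ Fz0; rewrite leeNy_eq.
Qed.

End Chaining.

(** * From the local estimate to [K], uniformly in the radius, the domain and the action *)

Theorem lemma2p4 (R : realType) (n : nat) (n_gt0 : (0 < n)%N)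
    (K : set 'rV[R[i]]_n) (K_connected : connected K) (K_compact : compact K)
    (K0 : K 0) (Rad s : R) (Rad_gt0 : 0 < Rad) (s_gt0 : 0 < s) :
  exists2 C : R, 0 < C &
    forall (r : R) (D : set 'rV[R[i]]_n),
      2 * r < Rad -> 2 * s < 2 * r ->
      domain D ->
      eball 0 (2 * r) `<=` D -> D `<=` eball 0 Rad ->
      eneighborhood K (3 * s) `<=` D ->
      forall (X : 'rV[R[i]]_n -> 'rV[R[i]]_n)
             (g : R -> 'rV[R[i]]_n -> 'rV[R[i]]_n),
        holomorphic_on D X ->
        one_parameter_action D g ->
        generates D g X ->
        (supnorm K X <= C%:E * supnorm (eball 0 r) X)%E.
Proof.
(* Then [16 * rho = 2 * s], so the balls required by [field_propagation] around points of [K] lie in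
   the [3 * s]-neighborhood. *)
pose rho := s / 8.
have rho0 : 0 < rho by rewrite /rho; lra.
have [C1 C10 prop] := @field_propagation R n Rad rho rho0.
pose admissible (r : R) D g X := [/\ s < r, eneighborhood K (3 * s) `<=` D &
  flow_on Rad D g X].
(* All of [r], [D], [g], [X] and [A] are quantified inside, so the constants found by chaining
   depend on none of them. *)
pose good q c := forall r D g X (A : R), admissible r D g X -> 0 < A ->
  (forall z, eball 0 r z -> enorm (X z) <= A) ->
  forall z, eball q rho z -> enorm (X z) <= c * A.
have mono q c c' : good q c -> c <= c' -> good q c'.
  move=> gq cc r D g X A adm A0 XA z zq.
  by apply: (le_trans (gq r D g X A adm A0 XA z zq)); rewrite ler_pM2r.
have [|q q' c Kq qq' gq|C C0 HC] := compact_connected_induction K_connected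
  K_compact K0 rho0 mono.
(* At 0 the constant is 1, since [rho < s < r] puts the small ball inside [eball 0 r]. *)
- exists 1 => r D g X A [sr _ _] A0 XA z z0; rewrite mul1r; apply: XA.
  by move: z0; rewrite /eball /rho /=; lra.
(* Positivity of [c1] makes [c1 * A] a legitimate bound for [prop], whose conclusion on the ball of
   radius [2 * rho] around [q] covers the ball of radius [rho] around [q']. *)
- pose c1 := Num.max c 1.
  have gq1 : good q c1 by apply: mono gq _; rewrite le_max lexx.
  have c10 : 0 < c1 by rewrite lt_max ltr01 orbT.
  exists (C1 * c1) => r D g X A adm A0 XA z zq'.
  have [_ KD fl] := adm; rewrite -mulrA.
  apply: (prop q D g X) => //.
  + move=> y yq; apply: KD; exists q => //.
    by move: yq; rewrite /eball /rho /=; lra.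
  + by rewrite mulr_gt0.
  + exact: (gq1 r D g X A).
  + by move: zq'; rewrite /eball /=; have := enorm_triangle q' z q; lra.
exists C => // r D _ sr _ _ DRad KD X g _ act gX.
have r0 : 0 < r by lra.
apply: supnorm_le => //; first by exists 0; rewrite /eball /= subrr enorm0.
move=> A A0 XA z Kz; have [q gq zq] := HC z Kz.
apply: (gq r D g X) => //; split => //; first by lra.
exact: flow_on_action.
Qed.
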